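(* Let $\mathcal{A}$ be a unital $C^*$-algebra. Then $\mathcal{M}\Phi_+(H_{\mathcal{A}})$ and $\mathcal{M}\Phi_-(H_{\mathcal{A}})$ are semigroups under multiplication (composition of operators).
   Context: $\mathcal{A}$ is a unital $C^*$-algebra; $H_{\mathcal{A}} = \ell^2(\mathcal{A})$ is the standard Hilbert $\mathcal{A}$-module, and $B^a(H_{\mathcal{A}})$ is the $C^*$-algebra of bounded adjointable $\mathcal{A}$-linear operators on it. $M \tilde\oplus N$ denotes a direct sum of closed submodules that is not necessarily orthogonal. A Hilbert module is finitely generated if it is the (algebraic) $\mathcal{A}$-linear span of a finite set. An isomorphism of Hilbert modules is a bounded $\mathcal{A}$-linear bijection (with bounded inverse). For $F \in B^a(H_{\mathcal{A}})$ consider closed submodules with $H_{\mathcal{A}} = M_1 \tilde\oplus N_1 = M_2 \tilde\oplus N_2$, $F(M_1) \subseteq M_2$, $F(N_1) \subseteq N_2$ and $F|_{M_1}: M_1 \to M_2$ an isomorphism. $F \in \mathcal{M}\Phi_+(H_{\mathcal{A}})$ if such a decomposition exists with $N_1$ finitely generated; $F \in \mathcal{M}\Phi_-(H_{\mathcal{A}})$ if such a decomposition exists with $N_2$ finitely generated. *)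

(* Defs.v *)
From HB Require Import structures.
From mathcomp Require Import all_boot all_order all_algebra.
From mathcomp Require Import complex.
From mathcomp Require Import boolp classical_sets functions reals.
From mathcomp Require Import topology normedtype sequences.

Set Implicit Arguments.
Unset Strict Implicit.
Unset Printing Implicit Defensive.

Import Order.TTheory GRing.Theory Num.Theory.
Import numFieldNormedType.Exports.

Local Open Scope classical_set_scope.
Local Open Scope ring_scope.
Local Open Scope complex_scope.

(* Normed modules and rings have no common extension in the hierarchy (other
   than its number fields), so that a normed algebra is a normed module with
   multiplication data, from which the ring structure is then recovered. *)
HB.mixin Record isBanachAlgebra (K : numFieldType) A
    of CompleteNormedModule K A := {
  bone : A;
  bmul : A -> A -> A;
  bmulA : associative bmul;
  bmul1x : left_id bone bmul;
  bmulx1 : right_id bone bmul;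
  bmulDl : left_distributive bmul +%R;
  bmulDr : right_distributive bmul +%R;
  bscaleAl : forall (c : K) (x y : A), c *: bmul x y = bmul (c *: x) y;
  bscaleAr : forall (c : K) (x y : A), c *: bmul x y = bmul x (c *: y);
  bnormM : forall x y : A, `|bmul x y| <= `|x| * `|y|
}.

#[short(type="banachAlgType")]
HB.structure Definition BanachAlgebra (K : numFieldType) :=
  {A of isBanachAlgebra K A & CompleteNormedModule K A}.

HB.instance Definition _ (K : numFieldType) (A : banachAlgType K) :=
  GRing.Zmodule_isPzRing.Build (BanachAlgebra.sort A)
    (@bmulA K A) (@bmul1x K A) (@bmulx1 K A) (@bmulDl K A) (@bmulDr K A).

(* The norm of a normed module over R[i] takes its values in R[i]; they are
   nonnegative, hence real. *)
HB.mixin Record isCStarAlgebra (R : realType) A of BanachAlgebra R[i] A := {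
  star : A -> A;
  starK : involutive star;
  starD : {morph star : x y / x + y};
  starZ : forall (c : R[i]) (x : A), star (c *: x) = Num.conj c *: star x;
  starM : forall x y : A, star (bmul x y) = bmul (star y) (star x);
  cstar_identity : forall x : A, `|bmul (star x) x| = `|x| ^+ 2
}.

#[short(type="cstarAlgType")]
HB.structure Definition CStarAlgebra (R : realType) :=
  {A of isCStarAlgebra R A & BanachAlgebra R[i] A}.

HB.instance Definition _ (R : realType) (A : cstarAlgType R) :=
  GRing.PzRing.copy (CStarAlgebra.sort A)
    (BanachAlgebra.sort (CStarAlgebra.sort A : banachAlgType R[i])).

(* Hilbert modules are right modules, with inner products A-linear in the
   second variable.  The series defining [inner x y] converges in norm as soon
   as x and y are square summable (Cauchy-Schwarz). *)
Definition ract (R : realType) (A : cstarAlgType R) (x : nat -> A) (a : A) :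
  nat -> A := fun n => x n * a.

Definition inner (R : realType) (A : cstarAlgType R) (x y : nat -> A) : A :=
  limn (series (fun n => star (x n) * y n)).

Definition hnorm (R : realType) (A : cstarAlgType R) (x : nat -> A) : R[i] :=
  sqrtC `|inner x x|.

Definition l2 (R : realType) (A : cstarAlgType R) : set (nat -> A) :=
  [set x | cvgn (series (fun n => star (x n) * x n))].
Arguments l2 {R} A.

(* The standard module H_A.  Its module operations are the pointwise ones of
   [nat -> A]; below they are carried out on the underlying sequences, and
   "z = x . a + y in H_A" is written [hseq z = ract x a + hseq y].  As
   square summable sequences are stable under these operations, such a z
   always exists (and is unique). *)
Definition HA (R : realType) (A : cstarAlgType R) : Type := set_type (l2 A).

Definition hseq (R : realType) (A : cstarAlgType R) (x : HA A) : nat -> A :=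
  \val x.
Coercion hseq : HA >-> Funclass.

Definition Alinear_on (R : realType) (A : cstarAlgType R)
    (M : set (HA A)) (F : HA A -> HA A) : Prop :=
  forall (x y z : HA A) (a : A), M x -> M y -> M z ->
    hseq z = ract x a + hseq y -> hseq (F z) = ract (F x) a + hseq (F y).

Definition bounded_on (R : realType) (A : cstarAlgType R)
    (M : set (HA A)) (F : HA A -> HA A) : Prop :=
  exists c : R[i], forall x, M x -> hnorm (F x) <= c * hnorm x.

Definition adjointable (R : realType) (A : cstarAlgType R)
    (F : HA A -> HA A) : Prop :=
  exists G : HA A -> HA A, forall x y : HA A, inner (F x) y = inner x (G y).

(* B^a(H_A) *)
Definition Ba (R : realType) (A : cstarAlgType R) : set (HA A -> HA A) :=
  [set F | [/\ Alinear_on setT F, bounded_on setT F & adjointable F]].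
Arguments Ba {R} A.

Definition closed_submodule (R : realType) (A : cstarAlgType R)
    (M : set (HA A)) : Prop :=
  [/\ forall z : HA A, hseq z = 0 -> M z,
      forall (x y z : HA A) (a : A), M x -> M y ->
        hseq z = ract x a + hseq y -> M z
    & forall x : HA A,
        (forall e : R[i], 0 < e -> exists2 y, M y & hnorm (hseq x - hseq y) < e)
        -> M x].

(* H_A is the direct, not necessarily orthogonal, sum of M and N. *)
Definition direct_sum (R : realType) (A : cstarAlgType R)
    (M N : set (HA A)) : Prop :=
  (forall x : HA A, exists m n : HA A,
     [/\ M m, N n & hseq x = hseq m + hseq n]) /\
  (forall x : HA A, M x -> N x -> hseq x = 0).

Definition finitely_generated (R : realType) (A : cstarAlgType R)
    (N : set (HA A)) : Prop :=
  exists (k : nat) (g : 'I_k -> HA A), forall x : HA A,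
    N x <-> exists a : 'I_k -> A, hseq x = \sum_(i < k) ract (g i) (a i).

(* The restriction of F to M is an isomorphism of M onto N; the last clause
   is the boundedness of the inverse. *)
Definition isomorphism_on (R : realType) (A : cstarAlgType R)
    (M N : set (HA A)) (F : HA A -> HA A) : Prop :=
  [/\ Alinear_on M F, bounded_on M F, set_bij M N F
    & exists c : R[i], forall x, M x -> hnorm x <= c * hnorm (F x)].

Definition MPhi_decomposition (R : realType) (A : cstarAlgType R)
    (F : HA A -> HA A) (M1 N1 M2 N2 : set (HA A)) : Prop :=
  [/\ closed_submodule M1 /\ closed_submodule N1,
      closed_submodule M2 /\ closed_submodule N2,
      direct_sum M1 N1 /\ direct_sum M2 N2,
      F @` M1 `<=` M2 /\ F @` N1 `<=` N2
    & isomorphism_on M1 M2 F].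

Definition MPhi_plus (R : realType) (A : cstarAlgType R) :
    set (HA A -> HA A) :=
  [set F | Ba A F /\ exists M1 N1 M2 N2 : set (HA A),
     MPhi_decomposition F M1 N1 M2 N2 /\ finitely_generated N1].
Arguments MPhi_plus {R} A.

Definition MPhi_minus (R : realType) (A : cstarAlgType R) :
    set (HA A -> HA A) :=
  [set F | Ba A F /\ exists M1 N1 M2 N2 : set (HA A),
     MPhi_decomposition F M1 N1 M2 N2 /\ finitely_generated N2].
Arguments MPhi_minus {R} A.

Definition is_semigroup (T : Type) (op : T -> T -> T) (S : set T) : Prop :=
  (forall x y, S x -> S y -> S (op x y)) /\
  (forall x y z, S x -> S y -> S z -> op x (op y z) = op (op x y) z).

(* Main.v *)
From HB Require Import structures.
From mathcomp Require Import all_boot all_order all_algebra.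
From mathcomp Require Import complex ssrAC ring lra.
From mathcomp Require Import boolp classical_sets functions reals.
From mathcomp Require Import topology normedtype sequences.
Require Import Defs.

Set Implicit Arguments.
Unset Strict Implicit.
Unset Printing Implicit Defensive.

Import Order.TTheory GRing.Theory Num.Theory.
Import numFieldNormedType.Exports.

Local Open Scope classical_set_scope.
Local Open Scope ring_scope.
Local Open Scope complex_scope.

(** Composition is associative, so the content is that both classes are closed
under it.  The idea is that of Atkinson's theorem: a decomposition exists
exactly when the operator is invertible on one side up to an operator whose
tails are uniformly small, and such one-sided inverses compose.

From a decomposition of F one reads off a bounded module map E, the inverse of
F on M1 extended by 0 along N2, such that 1 - E F is the projection onto N1 and
1 - F E the projection onto N2 ([quasi_inverse_of_decomposition]).  If N1 is
finitely generated, an open mapping argument shows that P = 1 - E F has the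
form x |-> sum of g_i z_i with finitely many g_i and coefficients bounded by
|x| ([finite_rank_of_range]).  If moreover D G = 1 - Q, then
  D E F G = 1 - (Q + D P G),
and K = Q + D P G is again a sum of operators of this form.  Since the tails of
each g_i tend to 0, the operator t_k K has norm at most 1/2 for some k, where
t_k deletes the first k coordinates ([finite_rank_tail_compact]).

Conversely let U T = 1 - K with |t_k K| <= 1/2 ([left_Atkinson]).  The Neumann
series inverts V = 1 - t_k K, and W = V^-1 t_k U satisfies W T = V^-1 t_k V, an
idempotent, and W T W = W.  From such a W one reads off a decomposition of T
with N1 the kernel of W T ([decomposition_of_quasi_inverse]), and this kernel is
the image under V^-1 of the span of the first k basis vectors, hence finitely
generated.  The lower class is treated in the same way from T U = 1 - K with
W = U V^-1 t_k ([right_Atkinson]).  That a composite is again adjointable is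
clear, adjoints composing in the reverse order.

All this takes place in H_A as a Banach space.  Its triangle inequality and the
monotonicity of its norm along segments of a sequence rest on the theorem that
star a * a is positive in a C*-algebra ([pos_star_mul]).  Positivity of a
self-adjoint h is taken to mean that |t - h| <= t for some t >= 0, a condition
visibly stable under sums, so that square roots obtained by iteration
([sqrt_sub1]) can replace spectral theory. *)

(** * The norm and the involution of a C*-algebra *)

Section CStarNorm.
Context (R : realType) (A : cstarAlgType R).
Implicit Types (a b c h k s : A) (t : R).

(** The norm of A takes values in R[i]; its real part makes the reals, with
their total order, available for estimates. *)
Definition nrm a : R := complex.Re `|a|.

Lemma nrmE a : `|a| = (nrm a)%:C.
Proof. by rewrite RRe_real // ger0_real. Qed.

Lemma nrm_ge0 a : 0 <= nrm a.
Proof. by rewrite -lecR -nrmE normr_ge0. Qed.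

Lemma nrm0 : nrm 0 = 0.
Proof. by rewrite /nrm normr0. Qed.

Lemma nrm_eq0 a : nrm a = 0 -> a = 0.
Proof. by move=> a0; apply/normr0_eq0; rewrite nrmE a0. Qed.

Lemma nrmD a b : nrm (a + b) <= nrm a + nrm b.
Proof. by rewrite -lecR rmorphD /= -!nrmE ler_normD. Qed.

Lemma nrmN a : nrm (- a) = nrm a.
Proof. by rewrite /nrm normrN. Qed.

Lemma nrmB a b : nrm (a - b) = nrm (b - a).
Proof. by rewrite /nrm distrC. Qed.

Lemma nrmM a b : nrm (a * b) <= nrm a * nrm b.
Proof. by rewrite -lecR rmorphM /= -!nrmE; apply: bnormM. Qed.

Lemma nrmZ (z : R[i]) a t : `|z| = t%:C -> nrm (z *: a) = t * nrm a.
Proof.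
by move=> zt; apply: complexI; rewrite rmorphM /= -!nrmE normrZ zt.
Qed.

Lemma nrmZr t a : nrm (t%:C *: a) = `|t| * nrm a.
Proof. by apply: nrmZ; rewrite normc_def /= expr0n /= addr0 sqrtr_sqr. Qed.

Lemma star_mul a b : star (a * b) = star b * star a.
Proof. exact: starM. Qed.

Lemma star0 : star (0 : A) = 0.
Proof. by apply: (addrI (star 0)); rewrite -starD !addr0. Qed.

Lemma starN a : star (- a) = - star a.
Proof. by apply: (addrI (star a)); rewrite -starD !subrr star0. Qed.

Lemma starB a b : star (a - b) = star a - star b.
Proof. by rewrite starD starN. Qed.

Lemma star1 : star (1 : A) = 1.
Proof. by rewrite -[LHS]mulr1 -{2}[1]starK -star_mul mulr1 starK. Qed.

Lemma starZr t a : star (t%:C *: a) = t%:C *: star a.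
Proof. by rewrite starZ conj_Creal //; apply/complex_realP; exists t. Qed.

Lemma starZi a : star ('i *: a)%R = - ('i *: star a)%R.
Proof. by rewrite starZ conjCi scaleNr. Qed.

Lemma scaleMl (z : R[i]) a b : (z *: a) * b = z *: (a * b).
Proof. by symmetry; apply: bscaleAl. Qed.

Lemma scaleMr (z : R[i]) a b : a * (z *: b) = z *: (a * b).
Proof. by symmetry; apply: bscaleAr. Qed.

Lemma nrm_cstar a : nrm (star a * a) = nrm a ^+ 2.
Proof.
by apply: complexI; rewrite rmorphXn /= -!nrmE; apply: cstar_identity.
Qed.

(** |a|^2 = |star a * a| <= |star a| |a| gives one inequality, and applying it
to star a the other. *)
Lemma nrm_star a : nrm (star a) = nrm a.
Proof.
have le b : nrm b <= nrm (star b).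
  have := nrmM (star b) b; rewrite nrm_cstar expr2.
  have [->|nb] := eqVneq (nrm b) 0; first by rewrite nrm_ge0.
  by rewrite ler_pM2r // lt0r nb nrm_ge0.
by apply/eqP; rewrite eq_le le -{2}[a]starK le.
Qed.

Lemma nrm_sq s : star s = s -> nrm (s * s) = nrm s ^+ 2.
Proof. by move=> ss; rewrite -nrm_cstar ss. Qed.

Lemma nrm1_le : nrm (1 : A) <= 1.
Proof.
have := nrm_sq star1; rewrite mulr1 expr2.
have [->|n1] := eqVneq (nrm (1 : A)) 0; first by rewrite ler01.
by rewrite -{1}[nrm 1]mulr1 => /(mulfI n1) <-.
Qed.

Lemma sq_eq0 s : star s = s -> s * s = 0 -> s = 0.
Proof.
move=> ss s0; apply: nrm_eq0; apply/eqP.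
by rewrite -sqrf_eq0 -nrm_sq // s0 nrm0.
Qed.

Lemma scaleI t a b : t != 0 -> t%:C *: a = t%:C *: b -> a = b.
Proof.
move=> t0 /(congr1 (fun x => (t^-1)%:C *: x)).
by rewrite !scalerA -!rmorphM /= mulVf // !scale1r.
Qed.

End CStarNorm.

(** * Limits and square roots in a C*-algebra *)

Section CStarLimits.
Context (R : realType) (A : cstarAlgType R).
Implicit Types (a b c h k s : A) (t e : R) (u v : nat -> A).

Lemma cvg_nrmP u a : u @ \oo --> a <->
  forall e, 0 < e -> exists N, forall n, (N <= n)%N -> nrm (u n - a) <= e.
Proof.
split=> [/cvgrPdist_le ua e e0|ua].
  have [|N _ Nn] := ua e%:C; first by rewrite ltcR.
  by exists N => n /Nn /=; rewrite nrmE lecR nrmB.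
apply/cvgrPdist_le => z z0.
have zE : z = (complex.Re z)%:C by rewrite RRe_real // gtr0_real.
move: z0; rewrite zE ltcR => /ua[N Nn].
by exists N => // n /Nn /=; rewrite nrmE lecR nrmB.
Qed.

Lemma cauchy_nrm_cvg u :
  (forall e, 0 < e -> exists N, forall m n, (N <= n)%N -> (n <= m)%N ->
     nrm (u m - u n) <= e) ->
  cvgn u.
Proof.
move=> uc; apply: cauchy_cvg; apply: cauchy_exP => z z0.
have zE : z = (complex.Re z)%:C by rewrite RRe_real // gtr0_real.
move: z0; rewrite zE ltcR; set e := complex.Re z => e0.
have [|N Nn] := uc (e / 2); first by rewrite divr_gt0.
exists (u N); exists N => // n /= Nlen; rewrite -ball_normE /= nrmE ltcR nrmB.
apply: (le_lt_trans (Nn _ _ _ _)) => //.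
by rewrite gtr_pMr // invf_lt1 // ltr1n.
Qed.

Lemma nrm_lim_le u a t : u @ \oo --> a ->
  (exists N, forall n, (N <= n)%N -> nrm (u n) <= t) -> nrm a <= t.
Proof.
move=> /cvg_nrmP ua [N uN]; apply/ler_addgt0Pr => e e0.
have [M uM] := ua _ e0; have := uM _ (leq_maxr N M).
have := uN _ (leq_maxl N M); set w := u _ => wt we.
rewrite -[a](subrK w) (le_trans (nrmD _ _)) // nrmB addrC lerD //.
Qed.

Lemma cvg_nrm_unique u a b : u @ \oo --> a -> u @ \oo --> b -> a = b.
Proof.
move=> ua ub; have := @cvg_unique A (@norm_hausdorff _ _) (u @ \oo) _.
by apply.
Qed.

Lemma cvg_mul u v a b : u @ \oo --> a -> v @ \oo --> b ->
  (fun n => u n * v n) @ \oo --> a * b.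
Proof.
move=> /cvg_nrmP ua /cvg_nrmP vb; apply/cvg_nrmP => e e0.
(* d is chosen so small that d^2 + d |b| + |a| d <= d (|a| + |b| + 1) <= e. *)
pose M := nrm a + nrm b + 1.
have na := nrm_ge0 a; have nb := nrm_ge0 b.
have M0 : 0 < M by rewrite /M; lra.
pose d := Num.min 1 (e / (M + M)).
have d0 : 0 < d by rewrite /d lt_min ltr01 divr_gt0 // addr_gt0.
have [N1 uN] := ua _ d0; have [N2 vN] := vb _ d0.
exists (maxn N1 N2) => n; rewrite geq_max => /andP[/uN ud /vN vd].
have -> : u n * v n - a * b =
    (u n - a) * (v n - b) + (u n - a) * b + a * (v n - b).
  by rewrite -mulrDr subrK mulrBl mulrBr addrA subrK.
have le3 : nrm ((u n - a) * (v n - b) + (u n - a) * b + a * (v n - b))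
    <= d * d + d * nrm b + nrm a * d.
  apply: (le_trans (nrmD _ _)); apply: lerD; last first.
    by apply: (le_trans (nrmM _ _)); rewrite ler_wpM2l.
  apply: (le_trans (nrmD _ _)); apply: lerD.
    by apply: (le_trans (nrmM _ _)); rewrite ler_pM ?nrm_ge0.
  by apply: (le_trans (nrmM _ _)); rewrite ler_wpM2r.
apply: (le_trans le3).
have d1 : d <= 1 by rewrite /d ge_min lexx.
have dM : d * (M + M) <= e.
  have MM : 0 < M + M by rewrite addr_gt0.
  by rewrite -(ler_pdivlMr _ _ MM) /d ge_min lexx orbT.
apply: (le_trans _ dM); rewrite /M; nra.
Qed.

Lemma cvg_star u a : u @ \oo --> a -> (fun n => star (u n)) @ \oo --> star a.
Proof.
move=> /cvg_nrmP ua; apply/cvg_nrmP => e /ua[N uN].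
by exists N => n /uN; rewrite -starB nrm_star.
Qed.

(** A square root 1 - y of 1 - x, on the whole closed unit ball and without
functional calculus.  The fixed point equation y = (x + y^2) / 2 is solved by
iteration from 0.  The iterates are polynomials in x with nonnegative
coefficients, so their increments are bounded by those of the real iteration
for x = 1, which increases to 1; being polynomials they commute with whatever
commutes with x. *)
Lemma sqrt_sub1 x : star x = x -> nrm x <= 1 ->
  exists y, [/\ star y = y, nrm y <= 1, (1 - y) * (1 - y) = 1 - x &
    forall c, c * x = x * c -> c * y = y * c].
Proof.
move=> sx x1.
pose half : R := 2^-1.
pose y := fix y n := if n is m.+1 then half%:C *: (x + y m * y m) else 0 : A.
pose t := fix t n := if n is m.+1 then (1 + t m * t m) / 2 else 0 : R.
have half0 : `|half| = half by rewrite ger0_norm // invr_ge0.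
have t01 n : 0 <= t n <= 1.
  elim: n => [|n /andP[t0 t1]] /=; first by rewrite lexx ler01.
  by apply/andP; split; nra.
have tS n : t n <= t n.+1.
  by have /andP[? ?] := t01 n; rewrite /=; nra.
have yt n : nrm (y n) <= t n.
  elim: n => [|n IH] /=; first by rewrite nrm0.
  have := nrmD x (y n * y n); have := nrmM (y n) (y n); have := nrm_ge0 (y n).
  by rewrite nrmZr half0 /half; have /andP[? ?] := t01 n; nra.
have ys n : star (y n) = y n.
  by elim: n => [|n IH] /=; rewrite ?star0 // starZr starD sx star_mul IH.
have yc c : c * x = x * c -> forall n, c * y n = y n * c.
  move=> cx; elim=> [|n IH] /=; first by rewrite mulr0 mul0r.
  by rewrite scaleMr scaleMl mulrDr mulrDl cx mulrA IH -mulrA IH mulrA.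
(* The increments factor as (y_(n+1) - y_n) (y_(n+1) + y_n) / 2, as do those of
the real iteration t. *)
have yd n : nrm (y n.+1 - y n) <= t n.+1 - t n.
  elim: n => [|n IH].
    by rewrite !subr0 /= mulr0 addr0 mulr0 addr0 nrmZr half0 /half; lra.
  have -> : y n.+2 - y n.+1 = half%:C *: ((y n.+1 - y n) * (y n.+1 + y n)).
    have cm := yc _ (esym (yc x erefl n)) n.+1.
    rewrite [y n.+2]/= [in X in _ - X]/= -scalerBr; congr (_ *: _).
    rewrite -[half%:C *: _]/(y n.+1) opprD addrACA subrr add0r.
    by rewrite mulrBl !mulrDr cm opprD addrA addrK.
  rewrite nrmZr half0 /half.
  have h1 := nrmM (y n.+1 - y n) (y n.+1 + y n).
  have h2 := nrmD (y n.+1) (y n).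
  have h3 := nrm_ge0 (y n.+1 + y n); have h4 := nrm_ge0 (y n.+1 - y n).
  have h5 := yt n; have h6 := yt n.+1.
  have h7 : nrm (y n.+1 - y n) * nrm (y n.+1 + y n) <=
      (t n.+1 - t n) * (t n.+1 + t n).
    by apply: ler_pM => //; apply: (le_trans h2); rewrite lerD.
  have -> : t n.+2 - t n.+1 = ((t n.+1 - t n) * (t n.+1 + t n)) / 2.
    by rewrite /=; field.
  by lra.
have ynm m n : (n <= m)%N -> nrm (y m - y n) <= t m - t n.
  move=> /subnK <-; elim: (m - n)%N => [|k IH].
    by rewrite add0n !subrr nrm0.
  rewrite addSn -(subrKA (y (k + n)%N)) (le_trans (nrmD _ _)) //.
  by have := yd (k + n)%N; lra.
have tcv : cvgn t.
  apply: nondecreasing_is_cvgn; first exact/nondecreasing_seqP.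
  by exists 1 => _ [n _ <-]; case/andP: (t01 n).
have /cvg_ex[l yl] : cvgn y.
  apply: cauchy_nrm_cvg => e e0.
  have := tcv => /cvgrPdist_le /(_ (e / 2)) []; first by rewrite divr_gt0.
  move=> N _ tN; exists N => m n Nn nm; apply: (le_trans (ynm _ _ nm)).
  have := tN _ Nn; have := tN _ (leq_trans Nn nm) => /=.
  by rewrite !ler_norml => /andP[? ?] /andP[? ?]; lra.
exists l; split.
- apply: (cvg_nrm_unique (u := y)) => //.
  by have := cvg_star yl; under eq_fun do rewrite ys.
- apply: (nrm_lim_le yl); exists 0%N => n _.
  by case/andP: (t01 n) => _; apply: le_trans.
- have lE : l = half%:C *: (x + l * l).
    apply: (cvg_nrm_unique (u := fun n => y n.+1)).
      by rewrite cvg_shiftS.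
    by apply: cvgZr; apply: cvgD; [exact: cvg_cst|exact: cvg_mul].
  have l2 : l + l = x + l * l.
    rewrite {1 2}lE -scalerDl -rmorphD /=.
    by rewrite /half (_ : 2^-1 + 2^-1 = 1) ?scale1r //; field.
  have -> : x = l + l - l * l by rewrite l2 addrK.
  rewrite mulrBl mul1r mulrBr mulr1 !opprB opprD !addrA.
  by congr (_ - _); rewrite addrAC.
- move=> c cx; apply: (cvg_nrm_unique (u := fun n => c * y n)).
    by apply: cvg_mul => //; exact: cvg_cst.
  by under eq_fun do rewrite (yc _ cx); apply: cvg_mul => //; exact: cvg_cst.
Qed.

End CStarLimits.

(** * The cone of positive elements *)

Section CStarPositive.
Context (R : realType) (A : cstarAlgType R).
Implicit Types (a b c d h k r s : A) (t e : R).

(** For self-adjoint h, the bound says that the spectrum of h lies in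
[0, 2t].  In this form the closure of positive elements under sums is the
triangle inequality. *)
Definition pos h : Prop :=
  star h = h /\ exists2 t, 0 <= t & nrm (t%:C *: (1 : A) - h) <= t.

Lemma pos0 : pos 0.
Proof. by split; [exact: star0|exists 0; rewrite ?scale0r ?subr0 ?nrm0]. Qed.

Lemma posD h k : pos h -> pos k -> pos (h + k).
Proof.
move=> [sh [t t0 ht]] [sk [e e0 ke]]; split; first by rewrite starD sh sk.
exists (t + e); first by rewrite addr_ge0.
rewrite rmorphD /= scalerDl opprD addrACA.
by apply: (le_trans (nrmD _ _)); rewrite lerD.
Qed.

Lemma posZ t h : 0 <= t -> pos h -> pos (t%:C *: h).
Proof.
move=> t0 [sh [e e0 he]]; split; first by rewrite starZr sh.
exists (t * e); first by rewrite mulr_ge0.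
by rewrite rmorphM /= -scalerA -scalerBr nrmZr ger0_norm // ler_wpM2l.
Qed.

Lemma posZV t h : 0 < t -> pos (t%:C *: h) -> pos h.
Proof.
move=> t0 /(posZ (t := t^-1)); rewrite scalerA -rmorphM /= mulVf ?gt_eqF //.
by rewrite scale1r invr_ge0; apply; rewrite ltW.
Qed.

Lemma pos_sum (I : Type) (r : seq I) (P : pred I) (F : I -> A) :
  (forall i, P i -> pos (F i)) -> pos (\sum_(i <- r | P i) F i).
Proof. by move=> Fp; elim/big_ind: _ => //; [exact: pos0|exact: posD]. Qed.

Lemma pos1B k : star k = k -> nrm k <= 1 -> pos (1 - k).
Proof.
move=> sk k1; split; first by rewrite starB star1 sk.
by exists 1; rewrite ?scale1r // opprB addrC subrK.
Qed.

(** u = s + i r is unitary, so |u| <= 1, and s is its real part. *)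
Lemma unit_pair s r : star s = s -> star r = r -> s * r = r * s ->
  s * s + r * r = 1 -> nrm s <= 1.
Proof.
move=> ss sr cm sr1.
pose u := s + ('i *: r)%R; pose v := s - ('i *: r)%R.
have su : star u = v by rewrite /u starD starZi ss sr.
have vu : v * u = 1.
  rewrite /u /v mulrDr !mulrBl scaleMl scaleMr cm addrA subrK.
  by rewrite scaleMl scaleMr scalerA -(expr2 'i%R) sqrCi scaleN1r opprK.
have nu : nrm u <= 1.
  rewrite -(@expr_le1 _ 2) ?nrm_ge0 // -nrm_cstar su vu; exact: nrm1_le.
have nv : nrm v <= 1 by rewrite -su nrm_star.
have -> : s = (2^-1)%:C *: (u + v).
  rewrite /u /v addrACA subrr addr0 scalerDr -scalerDl -rmorphD /=.
  by rewrite (_ : 2^-1 + 2^-1 = 1) ?scale1r //; field.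
rewrite nrmZr ger0_norm ?invr_ge0 //.
by have := nrmD u v; lra.
Qed.

(** After scaling, h = 1 - x with |x| <= 1, and [sqrt_sub1] applies.  The
commutation clause makes up for the absence of a functional calculus. *)
Lemma pos_sqrt h : pos h -> exists s, [/\ star s = s, pos s, s * s = h &
  forall c, c * h = h * c -> c * s = s * c].
Proof.
move=> [sh [t]]; rewrite le_eqVlt => /predU1P[<-|t0].
  rewrite scale0r sub0r nrmN => h0.
  have -> : h = 0 by apply: nrm_eq0; apply/eqP; rewrite eq_le h0 nrm_ge0.
  exists 0; split; [exact: star0|exact: pos0|exact: mulr0|].
  by move=> c _; rewrite mulr0 mul0r.
move=> ht; have t00 : t != 0 by rewrite gt_eqF.
pose x := 1 - (t^-1)%:C *: h.
have sx : star x = x by rewrite starB star1 starZr sh.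
have xE : x = (t^-1)%:C *: (t%:C *: (1 : A) - h).
  by rewrite scalerBr scalerA -rmorphM /= mulVf // scale1r.
have ti : 0 <= t^-1 by rewrite invr_ge0 ltW.
have x1 : nrm x <= 1 by rewrite xE nrmZr ger0_norm // ler_pdivrMl ?mulr1.
have [y [sy y1 yy yc]] := sqrt_sub1 sx x1.
exists ((Num.sqrt t)%:C *: (1 - y)); split.
- by rewrite starZr starB star1 sy.
- by apply: posZ; rewrite ?sqrtr_ge0 //; exact: pos1B.
- rewrite scaleMl scaleMr scalerA yy -rmorphM /= -expr2 sqr_sqrtr ?ltW //.
  by rewrite /x opprB addrC subrK scalerA -rmorphM /= mulfV // scale1r.
- move=> c ch; rewrite scaleMr scaleMl mulrBr mulrBl mul1r mulr1 yc //.
  by rewrite /x mulrBr mulrBl mulr1 mul1r scaleMr scaleMl ch.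
Qed.

(** For |s| <= 1 there is r with r^2 = 1 - s^2 commuting with s; then |r| <= 1
by [unit_pair], that is |1 - s^2| <= 1. *)
Lemma pos_sq s : star s = s -> pos (s * s).
Proof.
move=> ss; pose t := nrm s + 1.
have t0 : 0 < t by rewrite ltr_wpDl ?nrm_ge0.
pose p := (t^-1)%:C *: s.
have sp : star p = p by rewrite starZr ss.
have ti : 0 <= t^-1 by rewrite invr_ge0 ltW.
have p1 : nrm p <= 1.
  by rewrite nrmZr ger0_norm // ler_pdivrMl // mulr1 lerDl.
have spp : star (p * p) = p * p by rewrite star_mul sp.
have pp1 : nrm (p * p) <= 1.
  by apply: (le_trans (nrmM _ _)); rewrite mulr_ile1 ?nrm_ge0.
have [y [sy y1 yy yc]] := sqrt_sub1 spp pp1.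
have s1y : star (1 - y) = 1 - y by rewrite starB star1 sy.
have n1 : nrm (1 - y) <= 1.
  apply: (unit_pair s1y sp); last by rewrite yy subrK.
  by rewrite mulrBr mulrBl mul1r mulr1 yc // mulrA.
have -> : s * s = (t ^+ 2)%:C *: (p * p).
  rewrite /p scaleMl scaleMr !scalerA -!rmorphM /= expr2 mulfK ?gt_eqF //.
  by rewrite mulfV ?gt_eqF // scale1r.
apply: posZ; first by rewrite exprn_ge0 ?ltW.
split=> //; exists 1 => //; rewrite scale1r -yy.
by apply: (le_trans (nrmM _ _)); rewrite mulr_ile1 ?nrm_ge0.
Qed.

Lemma posM h k : pos h -> pos k -> h * k = k * h -> pos (h * k).
Proof.
move=> /pos_sqrt[s [ss _ sh sc]] /pos_sqrt[r [sr _ rk rc]] hk.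
have sr' : s * r = r * s by apply: rc; rewrite -sc.
have -> : h * k = (s * r) * (s * r).
  by rewrite -sh -rk !mulrA; congr (_ * _); rewrite -!mulrA sr'.
by apply: pos_sq; rewrite star_mul ss sr sr'.
Qed.

(** After scaling |k| <= 1, so that 1 - k, and with it 1 - h, is positive.  The
commuting square roots of h and 1 - h then have norm at most 1. *)
Lemma pos_nrm_le h k : pos h -> pos (k - h) -> nrm h <= nrm k.
Proof.
move=> hp khp.
suff main t : 0 < t -> nrm k <= t -> nrm h <= t.
  apply/ler_addgt0Pr => e e0; apply: main.
    by rewrite ltr_wpDl ?nrm_ge0.
  by rewrite lerDl ltW.
move=> t0 kt; have t00 : t != 0 by rewrite gt_eqF.
pose h' := (t^-1)%:C *: h; pose k' := (t^-1)%:C *: k.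
have ti : 0 <= t^-1 by rewrite invr_ge0 ltW.
have h'p : pos h' by exact: posZ.
have sk : star k = k by rewrite -[k](subrK h) starD hp.1 khp.1.
have k1 : pos (1 - k').
  by apply: pos1B; rewrite ?starZr ?sk // nrmZr ger0_norm // ler_pdivrMl ?mulr1.
have h1 : pos (1 - h').
  by rewrite -(subrKA k'); apply: posD => //; rewrite -scalerBr; exact: posZ.
have [s [ss _ sh sc]] := pos_sqrt h'p.
have [r [sr _ rh rc]] := pos_sqrt h1.
have s1 : nrm s <= 1.
  apply: (unit_pair ss sr); last by rewrite sh rh addrC subrK.
  by apply: rc; rewrite mulrBr mulrBl mulr1 mul1r -sh mulrA.
have : nrm h' <= 1 by rewrite -sh nrm_sq // expr_le1 ?nrm_ge0.
by rewrite nrmZr ger0_norm // ler_pdivrMl ?mulr1.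
Qed.

(** Bernoulli's inequality for q = d^2, with the positive remainder h kept
commuting with d so that it may be multiplied by q. *)
Lemma pos_bernoulli d n : star d = d ->
  exists h, [/\ pos h, h * d = d * h & (1 + d * d) ^+ n = 1 + (d * d) *+ n + h].
Proof.
move=> sd; set q := d * d.
have qp : pos q by exact: pos_sq.
have qd : q * d = d * q by rewrite /q mulrA.
elim: n => [|n [h [hp hd hn]]].
  exists 0; split; [exact: pos0|by rewrite mulr0 mul0r|].
  by rewrite expr0 mulr0n !addr0.
have hq : h * q = q * h by rewrite /q mulrA hd -mulrA hd mulrA.
exists (h + h * q + (q * q) *+ n); split.
- apply: posD; first by apply: posD => //; exact: posM.
  by elim: n {hn} => [|n IH]; rewrite ?mulr0n ?mulrS; [exact: pos0|
    apply: posD => //; exact: posM].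
- rewrite !mulrDl !mulrDr hd mulrnAl mulrnAr; congr (_ + _ + _ *+ _).
    by rewrite -mulrA qd !mulrA hd.
  by rewrite -mulrA qd !mulrA qd.
- rewrite -/q exprSr hn mulrDr mulr1 !mulrDl mul1r mulrnAl mulrS.
  by rewrite [LHS](AC (3*3) (1*(4*2)*(3*6*5))).
Qed.

End CStarPositive.

(** * Positivity of star a * a *)

Section CStarSquare.
Context (R : realType) (A : cstarAlgType R).
Implicit Types (a b c d h k r s : A) (t e : R).

Lemma sqD_sqB b :
  (b + star b) * (b + star b) - (b - star b) * (b - star b) =
  (star b * b + b * star b) *+ 2.
Proof.
rewrite !mulrDr !mulrDl !mulrN !mulNr opprK mulr2n.
rewrite !opprD !opprK.
set x := b * b; set y := star b * b.
set z := b * star b; set w := star b * star b.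
by rewrite [LHS](AC ((2*2)*(2*2)) ((1*5)*(4*8)*((2*3)*(6*7)))) /= !subrr !add0r.
Qed.

(** With b + star b and i (b - star b) as x and y, star b * b + b * star b is
half of x^2 + y^2, hence positive; adding - star b * b keeps it so. *)
Lemma pos_star_mulC b : pos (- (star b * b)) -> pos (b * star b).
Proof.
move=> bp; pose x := b + star b; pose y := ('i *: (b - star b))%R.
have sx : star x = x by rewrite starD starK addrC.
have sy : star y = y by rewrite starZi starB starK -scalerN opprB.
rewrite -[b * _](addKr (star b * b)); apply: posD => //.
apply: (@posZV R A 2) => //.
rewrite rmorph_nat scaler_nat -sqD_sqB; apply: posD; first exact: pos_sq.
suff -> : - ((b - star b) * (b - star b)) = y * y by exact: pos_sq.
by rewrite /y scaleMl scaleMr scalerA -(expr2 'i%R) sqrCi scaleN1r.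
Qed.

(** Put q = d^2 and c = b * star b.  The relation star b * b = - q gives
(1 - c) b = b (1 + q), hence (1 - c)^n b = b (1 + q)^n.  The left hand side
stays bounded, whereas |q (1 + q)^n| >= n |q^2| by Bernoulli's inequality. *)
Lemma neg_square_eq0_unit b d : star d = d -> star b * b = - (d * d) ->
  nrm (1 - b * star b) <= 1 -> d * d = 0.
Proof.
move=> sd; set q := d * d; set c := b * star b => bq c1.
have sq : star q = q by rewrite /q star_mul sd.
have qp : pos q by exact: pos_sq.
have cb n : (1 - c) ^+ n * b = b * (1 + q) ^+ n.
  elim: n => [|n IH]; first by rewrite !expr0 mul1r mulr1.
  rewrite exprSr -mulrA [(1 - c) * b](_ : _ = b * (1 + q)).
    by rewrite mulrA IH -mulrA -exprSr.
  by rewrite mulrBl mulrDr mul1r mulr1 /c -mulrA bq mulrN opprK.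
have nc n : nrm ((1 - c) ^+ n) <= 1.
  elim: n => [|n IH]; first exact: nrm1_le.
  by rewrite exprS (le_trans (nrmM _ _)) // mulr_ile1 ?nrm_ge0.
have le n : nrm (q * q) *+ n <= nrm b ^+ 2.
  have [h [hp hd hn]] := pos_bernoulli n sd.
  have qh : q * h = h * q by rewrite /q -mulrA -hd mulrA -hd -mulrA.
  apply: (@le_trans _ _ (nrm (q * (1 + q) ^+ n))); last first.
    rewrite -nrmN -mulNr -bq -mulrA -cb expr2 -{1}(nrm_star b).
    apply: (le_trans (nrmM _ _)); rewrite ler_wpM2l ?nrm_ge0 //.
    apply: (le_trans (nrmM _ _)); rewrite -[leRHS]mul1r ler_wpM2r ?nrm_ge0 //.
  have -> : nrm (q * q) *+ n = nrm ((q * q) *+ n).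
    rewrite -[RHS]/(nrm _) -(scaler_nat n (q * q)).
    by rewrite -(rmorph_nat (real_complex R)) nrmZr normr_nat mulr_natl.
  apply: pos_nrm_le.
    rewrite -(scaler_nat n (q * q)) -(rmorph_nat (real_complex R)).
    by apply: posZ; [exact: ler0n|exact: pos_sq].
  rewrite hn -/q mulrDr mulrDr mulr1 mulrnAr addrAC addrK.
  by apply: posD => //; exact: posM.
apply: sq_eq0 => //; apply: nrm_eq0; apply/eqP; rewrite eq_le nrm_ge0 andbT.
rewrite leNgt; apply/negP => q0.
have := le (Num.trunc (nrm b ^+ 2 / nrm (q * q))).+1.
rewrite -mulr_natr leNgt => /negP; apply.
by rewrite mulrC -ltr_pdivrMr // truncnS_gt.
Qed.

Lemma neg_square_eq0 b d : star d = d -> star b * b = - (d * d) -> d * d = 0.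
Proof.
move=> sd bd.
have [sc [t t0 ct]] : pos (b * star b).
  by apply: pos_star_mulC; rewrite bd opprK; exact: pos_sq.
(* Scaling b by (t + 1)^(-1/2) brings c = b * star b to |1 - c| <= 1; the shift
by 1 covers the case t = 0. *)
pose e := t + 1; have e0 : 0 < e by rewrite ltr_wpDl.
have ei : 0 <= e^-1 by rewrite invr_ge0 ltW.
pose f := Num.sqrt e^-1.
have ff : f * f = e^-1 by rewrite -expr2 sqr_sqrtr.
have := @neg_square_eq0_unit (f%:C *: b) (f%:C *: d).
rewrite !starZr !scaleMl !scaleMr !scalerA -!rmorphM /= ff => H.
apply: (@scaleI R A e^-1); first by rewrite invr_eq0 gt_eqF.
rewrite scaler0; apply: H; first by rewrite sd.
  by rewrite bd scalerN.
have -> : 1 - (e^-1)%:C *: (b * star b) =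
    (e^-1)%:C *: (t%:C *: (1 : A) - b * star b + 1).
  have te : t%:C *: (1 : A) + 1 = e%:C *: (1 : A).
    by rewrite rmorphD scalerDl scale1r.
  by rewrite addrAC te scalerBr scalerA -rmorphM /= mulVf ?gt_eqF // scale1r.
rewrite nrmZr ger0_norm // ler_pdivrMl // mulr1.
by apply: (le_trans (nrmD _ _)); rewrite lerD // nrm1_le.
Qed.

(** Let h = star a * a, k = |h| the positive square root of h^2 and r^2 = k.
For b = a (k - h) the commutation of h, k and r gives star b * b = - d^2 with
d = r (k - h), so d = 0 by [neg_square_eq0]; then k (k - h) = 0, and h = k. *)
Theorem pos_star_mul a : pos (star a * a).
Proof.
set h := star a * a.
have sh : star h = h by rewrite /h star_mul starK.
have [k [sk kp kk kc]] := pos_sqrt (pos_sq sh).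
have [r [sr _ rr rc]] := pos_sqrt kp.
have hk : h * k = k * h by apply: kc; rewrite mulrA.
have hr : h * r = r * h by exact: rc.
have kr : k * r = r * k by exact: rc.
have ks : star (k - h) = k - h by rewrite starB sk sh.
have khr : (k - h) * r = r * (k - h) by rewrite mulrBl mulrBr kr hr.
pose d := r * (k - h).
have sd : star d = d by rewrite star_mul sr ks khr.
have : d * d = 0.
  apply: (@neg_square_eq0 (a * (k - h))) => //.
  rewrite star_mul ks -mulrA [star a * _]mulrA -/h.
  have -> : d * d = (k - h) * (k * (k - h)).
    by rewrite /d -[X in X * _ = _]khr -!mulrA [r * (r * _)]mulrA rr.
  by rewrite -[RHS]mulrN; congr (_ * _); rewrite !mulrBr hk opprB kk.
move=> /(sq_eq0 sd) d0.
have kkh : k * (k - h) = 0 by rewrite -[X in X * _]rr -mulrA -/d d0 mulr0.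
suff -> : h = k by [].
apply/esym/eqP; rewrite -subr_eq0; apply/eqP; apply: sq_eq0 => //.
move: kkh; rewrite mulrBr => /eqP; rewrite subr_eq0 => /eqP kkh.
by rewrite mulrBl !mulrBr hk -kkh -kk kkh !subrr.
Qed.

End CStarSquare.

(** * Square sums of sequences *)

Section SquareSums.
Context (R : realType) (A : cstarAlgType R).
Implicit Types (a b : A) (x y : nat -> A) (e t : R) (m n : nat).

Definition sqsum m n x : A := \sum_(m <= i < n) star (x i) * x i.

(** The l2 norm of the segment of x with indices in [m, n). *)
Definition segnorm m n x : R := Num.sqrt (nrm (sqsum m n x)).

Lemma segnorm_sqr m n x : segnorm m n x ^+ 2 = nrm (sqsum m n x).
Proof. by rewrite sqr_sqrtr // nrm_ge0. Qed.

Lemma segnorm_ge0 m n x : 0 <= segnorm m n x.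
Proof. exact: sqrtr_ge0. Qed.

Lemma segnorm_le m n x t : 0 <= t ->
  (segnorm m n x <= t) = (nrm (sqsum m n x) <= t ^+ 2).
Proof. by move=> t0; rewrite -segnorm_sqr ler_sqr ?nnegrE ?segnorm_ge0. Qed.

Lemma pos_sqsum m n x : pos (sqsum m n x).
Proof. by apply: pos_sum => i _; exact: pos_star_mul. Qed.

Lemma segnorm_mono m m' n n' x : (m' <= m)%N -> (n <= n')%N ->
  segnorm m n x <= segnorm m' n' x.
Proof.
move=> mm nn; rewrite ler_sqrt ?nrm_ge0 //.
have [mn|nm] := leqP m n; last first.
  by rewrite {1}/sqsum big_geq ?nrm0 ?nrm_ge0 // ltnW.
apply: pos_nrm_le; first exact: pos_sqsum.
have -> : sqsum m' n' x - sqsum m n x = sqsum m' m x + sqsum n n' x.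
  rewrite /sqsum (big_cat_nat mm (leq_trans mn nn)) /=.
  by rewrite (big_cat_nat mn nn) /= addrA addrAC addrK.
by apply: posD; exact: pos_sqsum.
Qed.

Lemma segnorm_coord i x : segnorm i i.+1 x = nrm (x i).
Proof.
by rewrite /segnorm /sqsum big_nat1 nrm_cstar sqrtr_sqr ger0_norm ?nrm_ge0.
Qed.

(** The difference is the sum of star z * z for the terms
z = e^(1/2) a - e^(-1/2) b. *)
Lemma sqsum_polar m n x y e : 0 < e ->
  pos ((1 + e)%:C *: sqsum m n x + (1 + e^-1)%:C *: sqsum m n y
       - sqsum m n (x + y)).
Proof.
move=> e0; have ei : 0 <= e^-1 by rewrite invr_ge0 ltW.
rewrite /sqsum !scaler_sumr -big_split -sumrB /=.
apply: pos_sum => i _; set a := x i; set b := y i.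
pose f := Num.sqrt e; pose g := Num.sqrt e^-1.
have ff : f * f = e by rewrite -expr2 sqr_sqrtr ?ltW.
have gg : g * g = e^-1 by rewrite -expr2 sqr_sqrtr.
have fg : f * g = 1 by rewrite -sqrtrM ?ltW // mulfV ?sqrtr1 ?gt_eqF.
pose z := f%:C *: a - g%:C *: b.
suff -> : (1 + e)%:C *: (star a * a) + (1 + e^-1)%:C *: (star b * b)
       - star (a + b) * (a + b) = star z * z by exact: pos_star_mul.
rewrite /z starB !starZr starD !rmorphD /= rmorph1 !scalerDl !scale1r.
rewrite !mulrBr !mulrBl !mulrDr !mulrDl !scaleMl !scaleMr !scalerA -!rmorphM /=.
rewrite ff gg [g * f]mulrC fg !scale1r !opprD opprK.
by rewrite [LHS](AC ((2*2)*(2*2)) ((1*5)*(3*8)*((2*6)*(7*4)))) /= !subrr !add0r.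
Qed.

(** Minkowski's inequality without Cauchy-Schwarz: for X, Y > 0 the bound
(1 + q) X^2 + (1 + 1/q) Y^2 supplied by [sqsum_polar] equals (X + Y)^2 at
q = Y / X.  The slack d keeps X and Y away from 0. *)
Lemma segnormD m n x y : segnorm m n (x + y) <= segnorm m n x + segnorm m n y.
Proof.
apply/ler_addgt0Pr => e e0; pose d := e / 2.
have d0 : 0 < d by rewrite divr_gt0.
have X0 := segnorm_ge0 m n x; have Y0 := segnorm_ge0 m n y.
set X := segnorm m n x in X0 *; set Y := segnorm m n y in Y0 *.
have X'0 : 0 < X + d by rewrite ltr_wpDl.
have Y'0 : 0 < Y + d by rewrite ltr_wpDl.
have -> : X + Y + e = (X + d) + (Y + d) by rewrite /d; field.
rewrite segnorm_le; last by rewrite addr_ge0 ?ltW.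
pose q := (Y + d) / (X + d).
have q0 : 0 < q by rewrite divr_gt0.
have qi0 : 0 < q^-1 by rewrite invr_gt0.
apply: (le_trans (pos_nrm_le (pos_sqsum _ _ _) (sqsum_polar m n x y q0))).
have q1 : 0 <= 1 + q by lra.
have qi1 : 0 <= 1 + q^-1 by lra.
apply: (le_trans (nrmD _ _)); rewrite !nrmZr (ger0_norm q1) (ger0_norm qi1).
rewrite -!segnorm_sqr -/X -/Y.
have -> : (X + d + (Y + d)) ^+ 2 =
    (1 + q) * (X + d) ^+ 2 + (1 + q^-1) * (Y + d) ^+ 2.
  by rewrite /q; field; rewrite !gt_eqF.
by apply: lerD; apply: ler_wpM2l => //; rewrite ler_sqr ?nnegrE //; lra.
Qed.

Lemma segnorm_ract m n x a : segnorm m n (ract x a) <= segnorm m n x * nrm a.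
Proof.
rewrite segnorm_le ?mulr_ge0 ?segnorm_ge0 ?nrm_ge0 //.
have -> : sqsum m n (ract x a) = star a * sqsum m n x * a.
  rewrite /sqsum mulr_sumr mulr_suml; apply: eq_bigr => i _.
  by rewrite /ract star_mul !mulrA.
rewrite exprMn segnorm_sqr; apply: (le_trans (nrmM _ _)).
rewrite expr2 mulrA ler_wpM2r ?nrm_ge0 // mulrC -(nrm_star a).
by rewrite (le_trans (nrmM _ _)) // mulrC.
Qed.

Lemma segnormN m n x : segnorm m n (- x) = segnorm m n x.
Proof.
congr (Num.sqrt (nrm _)); apply: eq_bigr => i _.
by rewrite /= starN mulrNN.
Qed.

Lemma segnormZ m n x t :
  segnorm m n (fun i => t%:C *: x i) = `|t| * segnorm m n x.
Proof.
rewrite /segnorm -sqrtr_sqr -sqrtrM ?sqr_ge0 //; congr Num.sqrt.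
rewrite -[t ^+ 2]ger0_norm ?sqr_ge0 // -nrmZr /sqsum scaler_sumr.
congr nrm; apply: eq_bigr => i _.
by rewrite starZr scaleMl scaleMr scalerA -rmorphM expr2.
Qed.

Lemma l2P x : l2 A x <->
  forall e, 0 < e -> exists N, forall m n, (N <= m)%N -> segnorm m n x <= e.
Proof.
split=> [/cvg_ex[l /cvg_nrmP xl] e e0|xc].
  have [|N xN] := xl (e ^+ 2 / 2); first by rewrite divr_gt0 ?exprn_gt0.
  exists N => m n Nm; rewrite (segnorm_le _ _ _ (ltW e0)).
  have [mn|nm] := leqP m n; last first.
    by rewrite /sqsum big_geq ?nrm0 ?sqr_ge0 // ltnW.
  rewrite /sqsum -(sub_series_geq (fun i => star (x i) * x i) mn).
  rewrite -(subrKA l) (le_trans (nrmD _ _)) // [nrm (l - _)]nrmB.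
  by have := xN _ Nm; have := xN _ (leq_trans Nm mn); lra.
apply: cauchy_nrm_cvg => e e0.
have [|N xN] := xc (Num.sqrt e); first by rewrite sqrtr_gt0.
exists N => m n Nn nm; rewrite sub_series_geq //.
by have := xN _ m Nn; rewrite segnorm_le ?sqrtr_ge0 // (sqr_sqrtr (ltW e0)).
Qed.

Definition l2norm x : R := Num.sqrt (nrm (inner x x)).

Lemma hnormE x : hnorm x = (l2norm x)%:C.
Proof.
rewrite /hnorm nrmE -{1}(@sqr_sqrtr _ (nrm _)) ?nrm_ge0 //.
by rewrite rmorphXn /= sqrCK // ler0c sqrtr_ge0.
Qed.

Lemma l2norm_ge0 x : 0 <= l2norm x.
Proof. exact: sqrtr_ge0. Qed.

Lemma segnorm_le_l2norm n x : l2 A x -> segnorm 0 n x <= l2norm x.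
Proof.
move=> xl; rewrite segnorm_le ?l2norm_ge0 // sqr_sqrtr ?nrm_ge0 //.
apply/ler_addgt0Pr => e e0.
have := xl => /cvg_nrmP/(_ _ e0)[N /(_ _ (leq_maxl N n))].
set u := series _ _; set l := inner x x => ul.
have un : nrm (sqsum 0 n x) <= nrm u.
  by rewrite -ler_sqrt ?nrm_ge0 //; apply: segnorm_mono; rewrite ?leq_maxr.
by rewrite (le_trans un) // -[u](subrK l) (le_trans (nrmD _ _)) // addrC lerD2l.
Qed.

Lemma l2norm_le x t : l2 A x -> (forall n, segnorm 0 n x <= t) -> l2norm x <= t.
Proof.
move=> xl xt; have t0 : 0 <= t := le_trans (segnorm_ge0 _ _ _) (xt 0%N).
rewrite -ler_sqr ?nnegrE ?l2norm_ge0 // sqr_sqrtr ?nrm_ge0 //.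
by apply: (nrm_lim_le xl); exists 0%N => n _; rewrite -segnorm_le.
Qed.

End SquareSums.

(** * The standard module as a Banach space *)

Section StandardModule.
Context (R : realType) (A : cstarAlgType R).
Implicit Types (a b : A) (u v : nat -> A) (x y z : HA A) (e t : R) (m n : nat).

Lemma l2_dominated u v t :
  (forall m n, segnorm m n u <= t * segnorm m n v) -> l2 A v -> l2 A u.
Proof.
move=> uv /l2P vl; apply/l2P => e e0.
have t0 : 0 < `|t| + 1 by rewrite ltr_wpDl.
have [|N vN] := vl (e / (`|t| + 1)); first by rewrite divr_gt0.
exists N => m n Nm; apply: (le_trans (uv m n)).
have := vN m n Nm; rewrite ler_pdivlMr // => ve.
apply: (le_trans _ ve); rewrite mulrC ler_wpM2l ?segnorm_ge0 //.
by rewrite (le_trans (ler_norm _)) // lerDl.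
Qed.

Lemma l2_0 : l2 A 0.
Proof.
apply/l2P => e e0; exists 0%N => m n _.
rewrite /segnorm /sqsum big1 ?nrm0 ?sqrtr0 ?ltW // => i _.
exact: mulr0.
Qed.

Lemma l2D u v : l2 A u -> l2 A v -> l2 A (u + v).
Proof.
move=> /l2P ul /l2P vl; apply/l2P => e e0.
have e20 : 0 < e / 2 by rewrite divr_gt0.
have [N uN] := ul _ e20; have [M vM] := vl _ e20.
exists (maxn N M) => m n; rewrite geq_max => /andP[Nm Mm].
have ue := uN m n Nm; have ve := vM m n Mm.
by apply: (le_trans (segnormD _ _ _ _)); lra.
Qed.

Lemma l2N u : l2 A u -> l2 A (- u).
Proof. by apply: (l2_dominated (t := 1)) => m n; rewrite segnormN mul1r. Qed.

Lemma l2Z t u : l2 A u -> l2 A (fun n => t%:C *: u n).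
Proof. by apply: (l2_dominated (t := `|t|)) => m n; rewrite segnormZ. Qed.

Lemma l2_ract u a : l2 A u -> l2 A (ract u a).
Proof.
by apply: (l2_dominated (t := nrm a)) => m n; rewrite mulrC segnorm_ract.
Qed.

Definition HAof u (ul : l2 A u) : HA A := exist _ u (mem_set ul).

Lemma HAP x : l2 A (hseq x).
Proof. exact: set_mem (valP x). Qed.
Arguments HAP x : clear implicits.

Lemma HA_inj x y : hseq x = hseq y -> x = y.
Proof. exact: val_inj. Qed.

Definition hadd x y := HAof (l2D (HAP x) (HAP y)).
Definition hopp x := HAof (l2N (HAP x)).
Definition hzero := HAof l2_0.
(** Real scalars are enough for the Banach space arguments, and the norm may
then be real valued. *)
Definition hscale t x := HAof (l2Z (t := t) (HAP x)).
Definition hact x a := HAof (l2_ract (a := a) (HAP x)).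

Lemma haddA : associative hadd.
Proof. by move=> x y z; apply: HA_inj; exact: addrA. Qed.
Lemma haddC : commutative hadd.
Proof. by move=> x y; apply: HA_inj; exact: addrC. Qed.
Lemma hadd0 : left_id hzero hadd.
Proof. by move=> x; apply: HA_inj; exact: add0r. Qed.
Lemma haddN : left_inverse hzero hopp hadd.
Proof. by move=> x; apply: HA_inj; exact: addNr. Qed.

HB.instance Definition _ := Choice.copy (HA A) (set_type (l2 A)).
HB.instance Definition _ :=
  GRing.isZmodule.Build (HA A) haddA haddC hadd0 haddN.

Lemma hseqD x y : hseq (x + y) = hseq x + hseq y. Proof. by []. Qed.
Lemma hseqB x y : hseq (x - y) = hseq x - hseq y. Proof. by []. Qed.

Lemma hscaleA s t x : hscale s (hscale t x) = hscale (s * t) x.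
Proof.
apply: HA_inj; apply/funext => i /=.
by rewrite /hscale /hseq /= scalerA rmorphM.
Qed.
Lemma hscale1 : left_id 1 hscale.
Proof. by move=> x; apply: HA_inj; apply/funext => i; exact: scale1r. Qed.
Lemma hscaleDr : right_distributive hscale +%R.
Proof. by move=> t x y; apply: HA_inj; apply/funext => i; exact: scalerDr. Qed.
Lemma hscaleDl x : {morph hscale^~ x : s t / s + t}.
Proof.
move=> s t; apply: HA_inj; apply/funext => i.
by rewrite hseqD /hscale /hseq /= rmorphD scalerDl.
Qed.

HB.instance Definition _ := GRing.Zmodule_isLmodule.Build R (HA A)
  hscaleA hscale1 hscaleDr hscaleDl.

Definition hanorm x : R := l2norm (hseq x).

Lemma hanormD x y : hanorm (x + y) <= hanorm x + hanorm y.
Proof.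
apply: l2norm_le => [|n]; first exact: HAP.
apply: (le_trans (segnormD _ _ _ _)).
by apply: lerD; apply: segnorm_le_l2norm; exact: HAP.
Qed.

Lemma hanormZ_le t x : hanorm (t *: x) <= `|t| * hanorm x.
Proof.
apply: l2norm_le => [|n]; first exact: HAP.
by rewrite segnormZ ler_wpM2l //; apply: segnorm_le_l2norm; exact: HAP.
Qed.

Lemma hanormZ t x : hanorm (t *: x) = `|t| * hanorm x.
Proof.
apply/eqP; rewrite eq_le hanormZ_le /=; have [->|t0] := eqVneq t 0.
  by rewrite normr0 mul0r l2norm_ge0.
have := hanormZ_le t^-1 (t *: x); rewrite scalerA mulVf // scale1r normfV.
by rewrite ler_pdivlMl // normr_gt0.
Qed.

Lemma nrm_coord_le x i : nrm (hseq x i) <= hanorm x.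
Proof.
rewrite -segnorm_coord; apply: le_trans (segnorm_le_l2norm i.+1 (HAP x)).
exact: segnorm_mono.
Qed.

Lemma hanorm_eq0 x : hanorm x = 0 -> x = 0.
Proof.
move=> x0; apply: HA_inj; apply/funext => i; apply: nrm_eq0; apply/eqP.
by rewrite eq_le nrm_ge0 andbT -x0 nrm_coord_le.
Qed.

HB.instance Definition _ :=
  Lmodule_isNormed.Build R (HA A) hanormD hanormZ hanorm_eq0.

Lemma hanormE x : `|x| = l2norm (hseq x). Proof. by []. Qed.

End StandardModule.
Arguments HAP {R A} x.

Section StandardModuleComplete.
Context (R : realType) (A : cstarAlgType R).
Implicit Types (a b : A) (x y z : HA A) (e t : R) (m n : nat).

Lemma segnorm_lim m n (v : nat -> nat -> A) (l : nat -> A) t : 0 <= t ->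
  (forall i, v ^~ i @ \oo --> l i) ->
  (exists N, forall q, (N <= q)%N -> segnorm m n (v q) <= t) ->
  segnorm m n l <= t.
Proof.
move=> t0 vl [N vt]; rewrite segnorm_le //.
apply: (@nrm_lim_le R A (fun q => sqsum m n (v q))); last first.
  by exists N => q /vt; rewrite segnorm_le.
apply: cvg_big => [|i _]; first exact: add_continuous.
apply: cvg_mul => //; exact: cvg_star.
Qed.

Lemma HA_seq_complete (u : nat -> HA A) :
  (forall e, 0 < e -> exists N, forall p q, (N <= p)%N -> (N <= q)%N ->
     `|u p - u q| <= e) ->
  exists l, forall e, 0 < e ->
    exists N, forall p, (N <= p)%N -> `|u p - l| <= e.
Proof.
move=> uc.
have uci i : exists l : A, (fun p => hseq (u p) i) @ \oo --> l.
  have /cvg_ex[l il] : cvgn (fun p => hseq (u p) i); last by exists l.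
  apply: cauchy_nrm_cvg => e /uc[N uN]; exists N => p q Nq qp.
  have := uN _ _ (leq_trans Nq qp) Nq; apply: le_trans.
  exact: (nrm_coord_le (u p - u q) i).
have [l ul] := choice uci.
(* The coordinatewise limit is a limit uniformly over all segments. *)
have close e : 0 < e -> exists N, forall p, (N <= p)%N ->
    forall m n, segnorm m n (hseq (u p) - l) <= e.
  move=> e0; have [N uN] := uc _ e0; exists N => p Np m n.
  apply: (segnorm_lim (v := fun q => hseq (u p) - hseq (u q))).
  - exact: ltW.
    by move=> i; apply: cvgB; [exact: cvg_cst|exact: ul].
  exists N => q Nq; apply: le_trans (uN _ _ Np Nq).
  rewrite hanormE; have := segnorm_le_l2norm n (HAP (u p - u q)).
  apply: le_trans; exact: segnorm_mono.
have ll : l2 A l.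
  apply/l2P => e e0; have e2 : 0 < e / 2 by rewrite divr_gt0.
  have [N uN] := close _ e2.
  have [M uM] := (l2P (hseq (u N))).1 (HAP _) _ e2.
  exists M => m n Mm.
  have -> : l = hseq (u N) + - (hseq (u N) - l) by rewrite opprB addrC subrK.
  apply: (le_trans (segnormD _ _ _ _)); rewrite segnormN.
  by have := uM m n Mm; have := uN N (leqnn _) m n; lra.
exists (HAof ll) => e /close[N uN]; exists N => p Np.
by apply: l2norm_le => [|n]; [exact: (HAP (u p - HAof ll))|exact: uN].
Qed.

(** A Cauchy filter is reduced to a Cauchy sequence by choosing, for each n, a
point whose ball of radius 1 / (n + 1) belongs to the filter. *)
Lemma HA_complete (F : set_system (HA A)) : ProperFilter F -> cauchy F -> cvg F.
Proof.
move=> FF /cauchyP Fc.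
have r0 n : 0 < n.+1%:R^-1 :> R by rewrite invr_gt0.
have [u uF] := choice (fun n => Fc _ (r0 n)).
have lt_inv e : 0 < e -> exists N, forall n, (N <= n)%N -> n.+1%:R^-1 <= e :> R.
  move=> e0; exists (Num.trunc e^-1) => n Nn.
  rewrite -[leRHS]invrK lef_pV2 ?posrE ?invr_gt0 //.
  by rewrite (le_trans (ltW (truncnS_gt _))) // ler_nat.
have [|l ul] := @HA_seq_complete u.
  move=> e e0; have [|N uN] := lt_inv (e / 2); first by rewrite divr_gt0.
  exists N => p q Np Nq.
  have [y [/=]] := filter_ex (filterI (uF p) (uF q)).
  rewrite -!ball_normE /= => yp yq.
  apply: (le_trans (ler_distD y _ _)); rewrite [e]splitr [`|y - _|]distrC.
  apply: lerD; first exact: (le_trans (ltW yp) (uN _ Np)).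
  exact: (le_trans (ltW yq) (uN _ Nq)).
apply/cvg_ex; exists l; apply/fcvgrPdist_lt => e e0.
have e2 : 0 < e / 2 by rewrite divr_gt0.
have [N uN] := lt_inv _ e2; have [M uM] := ul _ e2.
have := uN _ (leq_maxl N M); have := uM _ (leq_maxr N M).
move: (uF (maxn N M)); set p := maxn N M => Fp up pe.
near=> y; have : ball (u p) p.+1%:R^-1 y by near: y.
rewrite -ball_normE /= => py.
apply: (le_lt_trans (ler_distD (u p) _ _)); rewrite [e]splitr [`|l - _|]distrC.
exact: (ler_ltD up (lt_le_trans py pe)).
Unshelve. all: by end_near. Qed.

HB.instance Definition _ := Uniform_isComplete.Build (HA A) HA_complete.

End StandardModuleComplete.

(** * Open mappings and Neumann series *)

Section Banach.
Context (R : realType).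

Lemma norm_lim_le (V : completeNormedModType R) (u : nat -> V) (l : V) (t : R) :
  u @ \oo --> l -> (forall n, `|u n| <= t) -> `|l| <= t.
Proof.
move=> /cvgrPdist_le ul ut; apply/ler_addgt0Pr => e.
move=> /ul[N _ /(_ N (leqnn N)) lN].
by rewrite -[l](subrK (u N)) (le_trans (ler_normD _ _)) // addrC lerD ?ut.
Qed.

Lemma halving_cvg (V : completeNormedModType R) (u : nat -> V) (r : R) :
  (forall k, `|u k| <= r / 2 ^+ k) ->
  exists l, series u @ \oo --> l /\ `|l| <= 2 * r.
Proof.
move=> ur.
have r0 : 0 <= r.
  by have := le_trans (normr_ge0 _) (ur 0%N); rewrite expr0 divr1.
have su n : \sum_(0 <= k < n) `|u k| <= 2 * r - 2 * r / 2 ^+ n.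
  elim: n => [|n IH]; first by rewrite big_nil expr0 divr1 subrr.
  rewrite big_nat_recr //= (le_trans (lerD IH (ur n))) // exprS.
  have p0 : 2 ^+ n != 0 :> R by rewrite expf_neq0 ?pnatr_eq0.
  by rewrite le_eqVlt; apply/orP; left; apply/eqP; field.
have sr n : \sum_(0 <= k < n) `|u k| <= 2 * r.
  by rewrite (le_trans (su n)) // gerBl !mulr_ge0 ?invr_ge0 ?exprn_ge0.
have /cvg_ex[l ul] : cvgn (series u).
  apply: normed_cvg; apply: nondecreasing_is_cvgn.
    apply/nondecreasing_seqP => n.
    suff : \sum_(0 <= k < n) `|u k| <= \sum_(0 <= k < n.+1) `|u k| by [].
    by rewrite big_nat_recr //= lerDl.
  by exists (2 * r) => _ [n _ <-]; exact: sr.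
exists l; split=> //; apply: (norm_lim_le ul) => n.
exact: le_trans (ler_norm_sum _ _ _) (sr n).
Qed.

(** The open mapping theorem for a closed linear relation G with range V.  It
covers at once the boundedness of the projections of a direct sum (z is the
component of x) and the boundedness of coefficients with respect to finitely
many generators (z is the vector of coefficients).

By Baire's theorem the closure of the set of those x related to some z of norm
at most n contains a ball for some n.  By linearity every x is then related,
up to an error |x| / 2, to some z with |z| <= c |x|.  Iterating on the error
and summing gives an exact solution, as G is closed. *)
Theorem open_mapping_relation (Z V : completeNormedModType R)
    (G : Z -> V -> Prop) :
  (forall z z' x x', G z x -> G z' x' -> G (z - z') (x - x')) ->
  (forall t z x, G z x -> G (t *: z) (t *: x)) ->
  (forall z x, (forall e : R, 0 < e -> exists z' x',
     [/\ G z' x', `|z - z'| <= e & `|x - x'| <= e]) -> G z x) ->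
  (forall x, exists z, G z x) ->
  exists2 c, 0 <= c & forall x, exists2 z, G z x & `|z| <= c * `|x|.
Proof.
move=> GB GZ Gcl Gonto.
have GD z z' x x' : G z x -> G z' x' -> G (z + z') (x + x').
  move=> g g'; rewrite -[z']opprK -[x']opprK; apply: GB => //.
  by rewrite -[- z']scaleN1r -[- x']scaleN1r; exact: GZ.
pose C n := [set x | exists2 z, G z x & `|z| <= n%:R].
have [n [O [[x0 Ox0] oO OC]]] : exists n O, [/\ O !=set0, open O &
    O `<=` closure (C n)].
  apply: contrapT => nex.
  have : dense (\bigcap_n (~` closure (C n))).
    apply: Baire => n; split; first exact/closed_openC/closed_closure.
    move=> O O0 oO; apply: contrapT => /set0P/negP; rewrite negbK => /eqP OC.
    apply: nex; exists n, O; split=> //.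
    exact/subsets_disjoint.
  move=> /(_ setT) []; [by exists 0|exact: openT|move=> x [_ xC]].
  have [z gz] := Gonto x.
  apply: (xC (Num.trunc `|z|).+1) => //; apply: subset_closure.
  by exists z => //; rewrite ltW // truncnS_gt.
have [rho rho0 ballO] : exists2 rho, 0 < rho & ball x0 rho `<=` O.
  by have /nbhs_ballP[rho /= ? ?] := open_nbhs_nbhs (conj oO Ox0); exists rho.
have clC x e : closure (C n) x -> 0 < e -> exists2 y, C n y & `|x - y| < e.
  move=> xC e0; have [y [Cy]] := xC _ (nbhsx_ballx x e e0).
  by rewrite -ball_normE /=; exists y.
pose c : R := 4 * n%:R / rho.
have c0 : 0 <= c by apply: divr_ge0; [exact: mulr_ge0|exact: ltW].
have step (p : V * R) : exists q : Z * V, 0 < p.2 -> `|p.1| <= p.2 ->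
    [/\ G q.1 q.2, `|q.1| <= c * p.2 & `|p.1 - q.2| <= p.2 / 2].
  case: p => x r /=; have [r0|] := ltP 0 r; last by exists (0, 0).
  (* t carries a ball of radius r into the ball of radius rho about x0; the
  tolerance e is a quarter of t r because two approximations are subtracted. *)
  pose t := rho / (2 * r); have t0 : 0 < t by rewrite divr_gt0 ?mulr_gt0.
  pose e := t * r / 4.
  have e0 : 0 < e by apply: divr_gt0 => //; exact: mulr_gt0.
  have [xr|] := leP `|x| r; last by exists (0, 0).
  have trE : t * r = rho / 2 by rewrite /t; field; rewrite gt_eqF.
  have [] := @clC (x0 + t *: x) e _ e0.
    apply/OC/ballO; rewrite -ball_normE /= opprD addrA subrr sub0r normrN.
    rewrite normrZ.
    rewrite gtr0_norm // (le_lt_trans (ler_wpM2l (ltW t0) xr)) // trE.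
    by rewrite gtr_pMr // invf_lt1 // ltr1n.
  move=> y1 [z1 gz1 zn1] xy1.
  have [] := @clC x0 e _ e0; first by apply/OC/ballO; exact: ballxx.
  move=> y0 [z0 gz0 zn0] xy0.
  exists (t^-1 *: (z1 - z0), t^-1 *: (y1 - y0)) => _ _ /=; split.
  - by apply: GZ; exact: GB.
  - rewrite normrZ gtr0_norm ?invr_gt0 //.
    have -> : c * r = t^-1 * (n%:R + n%:R).
      by rewrite /c /t; field; rewrite !gt_eqF.
    rewrite ler_pM2l ?invr_gt0 // (le_trans (ler_normB _ _)) // lerD //.
  - rewrite -[x](scalerK (lt0r_neq0 t0)) -scalerBr normrZ.
    rewrite gtr0_norm ?invr_gt0 //.
    rewrite ler_pdivrMl //.
    have -> : t *: x - (y1 - y0) = (x0 + t *: x - y1) - (x0 - y0).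
      by rewrite !opprB [RHS](AC (3*2) ((1*5)*(2*(4*3)))) /= subrr add0r.
    rewrite (le_trans (ler_normB _ _)) //.
    have := ltW xy1; have := ltW xy0; rewrite /e; lra.
have [f fP] := choice step.
exists (2 * c); first by rewrite mulr_ge0.
move=> x; have [->|x0'] := eqVneq x 0.
  have [z /(GZ 0)] := Gonto x; rewrite !scale0r => G00.
  by exists 0; rewrite // !normr0 mulr0.
pose r := `|x|; have r0 : 0 < r by rewrite normr_gt0.
have rk0 k : 0 < r / 2 ^+ k by rewrite divr_gt0 ?exprn_gt0.
(* w k is the error left after k approximations, and g k the next one. *)
pose w := fix w k := if k is k'.+1 then w k' - (f (w k', r / 2 ^+ k')).2 else x.
have wr k : `|w k| <= r / 2 ^+ k.
  elim: k => [|k IH] /=; first by rewrite expr0 divr1.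
  have [_ _] := fP (w k, r / 2 ^+ k) (rk0 k) IH.
  by rewrite /= exprS invfM mulrA mulrAC -mulrA mulrC.
pose g k := f (w k, r / 2 ^+ k).
have gP k : [/\ G (g k).1 (g k).2, `|(g k).1| <= c * (r / 2 ^+ k) &
    `|w k - (g k).2| <= r / 2 ^+ k / 2] by apply: fP; [exact: rk0|exact: wr].
have [z [zl zn]] : exists z, series (fun k => (g k).1) @ \oo --> z /\
    `|z| <= 2 * (c * r).
  by apply: halving_cvg => k; have [_ + _] := gP k; rewrite mulrA.
exists z; last by rewrite -mulrA.
have Gn k : G (series (fun k => (g k).1) k) (x - w k).
  elim: k => [|k IH].
    have [/(GZ 0) + _ _] := gP 0%N.
    by rewrite /series /= big_nil subrr !scale0r.
  rewrite /series /= big_nat_recr //= opprB [_.2 - _]addrC addrA.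
  by apply: GD => //; have [] := gP k.
apply: Gcl => e e0; have /cvgrPdist_le /(_ _ e0)[N _ zN] := zl.
have [M Me] : exists M, forall k, (M <= k)%N -> r / 2 ^+ k <= e.
  have half1 : `|2^-1 : R| < 1.
    by rewrite ger0_norm ?invr_ge0 // invf_lt1 // ltr1n.
  have /cvgrPdist_le/(_ _ e0)[M _ rM] := cvg_geometric r half1.
  exists M => k /rM; rewrite /geometric /= sub0r normrN exprVn.
  by apply: le_trans; rewrite ler_norm.
exists (series (fun k => (g k).1) (maxn N M)), (x - w (maxn N M)); split=> //.
  by apply: zN; exact: leq_maxl.
by rewrite opprB addrC subrK (le_trans (wr _)) // Me // leq_maxr.
Qed.

(** B y is the limit of the sums of S^k y, and |x| <= 2 |x - S x| makes it the
only solution. *)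
Lemma neumann (V : completeNormedModType R) (S : V -> V) :
  {morph S : x y / x - y} -> (forall x, `|S x| <= `|x| / 2) ->
  exists B : V -> V, [/\ forall x, B (x - S x) = x,
    forall y, B y - S (B y) = y & forall y, `|B y| <= 2 * `|y|].
Proof.
move=> SB Sh.
have S0 : S 0 = 0 by have := SB 0 0; rewrite !subrr.
have SN x : S (- x) = - S x by have := SB 0 x; rewrite sub0r S0 sub0r.
have SD x y : S (x + y) = S x + S y by rewrite -{1}[y]opprK SB SN opprK.
have bnd x : `|x| <= 2 * `|x - S x|.
  by have := ler_distD (S x) x 0; have := Sh x; rewrite !subr0; lra.
have ex y : exists l, l - S l = y.
  have uy k : `|iter k S y| <= `|y| / 2 ^+ k.
    elim: k => [|k IH] /=; first by rewrite expr0 divr1.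
    by rewrite (le_trans (Sh _)) // exprSr invfM mulrA ler_pM2r ?invr_gt0.
  have [l [yl _]] := halving_cvg uy.
  pose s n := series (fun k => iter k S y) n.
  have s0 : s 0%N = 0 by rewrite /s /series /= big_geq.
  have sr n : s n.+1 = s n + iter n S y by exact: seriesSr.
  have sS n : s n.+1 = y + S (s n).
    elim: n => [|n IH]; first by rewrite sr s0 S0 addrC.
    by rewrite sr [in RHS]sr SD IH addrA.
  exists l; apply/eqP; rewrite -subr_eq0 -normr_le0; apply/ler_addgt0Pr => e e0.
  have e2 : 0 < e / 2 by rewrite divr_gt0.
  have /cvgrPdist_le/(_ _ e2)[N _ lN] := yl.
  have := lN _ (leqnn N); have := lN _ (leqnSn N).
  rewrite /= -!/(s _) sS => l1 l0.
  have -> : l - S l - y = (l - (y + S (s N))) - S (l - s N).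
    rewrite SB opprB opprD [RHS](AC ((1*2)*2) (1*5*2*(3*4))) /=.
    by rewrite addNr addr0.
  rewrite add0r (le_trans (ler_normB _ _)) // [e]splitr lerD //.
  rewrite (le_trans (Sh _)) //; have := normr_ge0 (l - s N); lra.
have [B BP] := choice ex; exists B; split=> [x|y|y] //.
  apply/eqP; rewrite -subr_eq0 -normr_le0; have := bnd (B (x - S x) - x).
  rewrite SB opprB [X in 2 * `|X|](AC (2*2) ((1*4)*(3*2))) /= BP.
  by rewrite addrA subrK subrr normr0 mulr0.
by have := bnd (B y); rewrite BP.
Qed.

End Banach.

(** * Module operators, decompositions and quasi-inverses *)

Section Operators.
Context (R : realType) (A : cstarAlgType R).
Implicit Types (a b : A) (x y z : HA A) (e c t : R) (k m n : nat).
Implicit Types (F G T U E P S : HA A -> HA A).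

Lemma hactDl x y a : hact (x + y) a = hact x a + hact y a.
Proof. by apply: HA_inj; apply/funext => i; exact: mulrDl. Qed.

Lemma hactDr x a b : hact x (a + b) = hact x a + hact x b.
Proof. by apply: HA_inj; apply/funext => i; exact: mulrDr. Qed.

Lemma hactNl x a : hact (- x) a = - hact x a.
Proof. by apply: HA_inj; apply/funext => i; exact: mulNr. Qed.

Lemma hactA x a b : hact (hact x a) b = hact x (a * b).
Proof.
by apply: HA_inj; apply/funext => i; rewrite /hact /hseq /= /ract mulrA.
Qed.

Lemma hact1 x : hact x 1 = x.
Proof. by apply: HA_inj; apply/funext => i; exact: mulr1. Qed.

Lemma hact0l a : hact 0 a = 0.
Proof. by apply: HA_inj; apply/funext => i; exact: mul0r. Qed.

Lemma hact_scale x t : hact x (t%:C *: (1 : A)) = t *: x.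
Proof.
apply: HA_inj; apply/funext => i.
rewrite -[LHS]/(hseq x i * (t%:C *: (1 : A))) -[RHS]/(t%:C *: hseq x i).
by rewrite scaleMr mulr1.
Qed.

Lemma hact_norm x a : `|hact x a| <= `|x| * nrm a.
Proof.
apply: l2norm_le => [|n]; first exact: (HAP (hact x a)).
apply: (le_trans (segnorm_ract _ _ _ _)); rewrite ler_wpM2r ?nrm_ge0 //.
exact: segnorm_le_l2norm (HAP x).
Qed.

Definition modlin F := forall x y a, F (hact x a + y) = hact (F x) a + F y.

Definition bounded_op F := exists2 c, 0 <= c & forall x, `|F x| <= c * `|x|.

(** The bounded module maps of H_A, whether or not they have an adjoint. *)
Definition modop F := modlin F /\ bounded_op F.

Lemma modop0 F : modop F -> F 0 = 0.
Proof.
move=> [Fl _]; have := Fl 0 0 1; rewrite !hact1 addr0 => F0.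
by apply: (addrI (F 0)); rewrite addr0 -F0.
Qed.

Lemma modopD F x y : modop F -> F (x + y) = F x + F y.
Proof. by move=> [Fl _]; rewrite -[x]hact1 Fl !hact1. Qed.

Lemma modop_hact F x a : modop F -> F (hact x a) = hact (F x) a.
Proof. by move=> oF; have := oF.1 x 0 a; rewrite (modop0 oF) !addr0. Qed.

Lemma modopN F x : modop F -> F (- x) = - F x.
Proof.
by move=> oF; apply: (addrI (F x)); rewrite -modopD // !subrr modop0.
Qed.

Lemma modopB F x y : modop F -> F (x - y) = F x - F y.
Proof. by move=> oF; rewrite modopD // modopN. Qed.

Lemma modop_sum F k (g : 'I_k -> HA A) : modop F ->
  F (\sum_(i < k) g i) = \sum_(i < k) F (g i).
Proof.
by move=> oF; apply: (big_morph F) => [x y|]; [exact: modopD|exact: modop0].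
Qed.

Lemma modop_comp F G : modop F -> modop G -> modop (F \o G).
Proof.
move=> [Fl [c c0 Fc]] [Gl [d d0 Gd]]; split.
  by move=> x y a /=; rewrite Gl Fl.
exists (c * d); first exact: mulr_ge0.
by move=> x; rewrite -mulrA (le_trans (Fc _)) // ler_wpM2l.
Qed.

Lemma modop_id : modop id.
Proof. by split=> //; exists 1 => // x; rewrite mul1r. Qed.

Lemma modop_sub F G : modop F -> modop G -> modop (fun x => F x - G x).
Proof.
move=> [Fl [c c0 Fc]] [Gl [d d0 Gd]]; split.
  by move=> x y a; rewrite Fl Gl hactDl hactNl opprD addrACA.
exists (c + d); first exact: addr_ge0.
by move=> x; rewrite mulrDl (le_trans (ler_normB _ _)) // lerD.
Qed.

Lemma hnorm_norm x : hnorm (hseq x) = `|x|%:C.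
Proof. exact: hnormE. Qed.

Lemma hseq_comb x y z a :
  hseq z = ract (hseq x) a + hseq y <-> z = hact x a + y.
Proof. by split=> [h|->//]; exact: HA_inj. Qed.

Lemma modopP F : modop F <-> Alinear_on setT F /\ bounded_on setT F.
Proof.
split=> [[Fl [c c0 Fc]]|[Fl [c Fc]]]; split.
- by move=> x y z a _ _ _ /hseq_comb ->; rewrite Fl.
- by exists c%:C => x _; rewrite !hnorm_norm -rmorphM lecR.
- by move=> x y a; apply/hseq_comb; exact: Fl.
- have nc : `|c| = (complex.Re `|c|)%:C by rewrite RRe_real // ger0_real.
  exists (complex.Re `|c|); first by rewrite -ler0c -nc.
  move=> x; rewrite -lecR rmorphM /= -nc -!hnorm_norm.
  have x0 : 0 <= hnorm (hseq x) by rewrite hnorm_norm ler0c.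
  have Fx0 : 0 <= hnorm (hseq (F x)) by rewrite hnorm_norm ler0c.
  have cx := Fc x I.
  by rewrite -[X in _ * X]ger0_norm // -normrM (ger0_norm (le_trans Fx0 cx)).
Qed.

Lemma closed_submodule_ker F : modop F -> closed_submodule [set x | F x = 0].
Proof.
move=> oF; have [_ [c c0 Fc]] := oF; split=> /=.
- by move=> z z0; rewrite (_ : z = 0) ?modop0 //; exact: HA_inj.
- by move=> x y z a Fx Fy /hseq_comb ->; rewrite oF.1 Fx Fy hact0l addr0.
- move=> x xc; apply/normr0_eq0/eqP; rewrite eq_le normr_ge0 andbT.
  apply/ler_addgt0Pr => e e0; rewrite add0r.
  have c10 : 0 < c + 1 by rewrite ltr_wpDl.
  have [|y Fy] := xc (e / (c + 1))%:C; first by rewrite ltcR divr_gt0.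
  rewrite -hseqB hnorm_norm ltcR => xy.
  have -> : F x = F (x - y) by rewrite modopB // Fy subr0.
  apply: (le_trans (Fc _)); move: xy; rewrite ltr_pdivlMr //.
  by have := normr_ge0 (x - y); nra.
Qed.

(** U T and T U are idempotents, and T maps the range of the first onto that of
the second with inverse U. *)
Lemma decomposition_of_quasi_inverse T U : modop T -> modop U ->
  (forall x, U (T (U x)) = U x) ->
  MPhi_decomposition T [set x | U (T x) = x] [set x | U (T x) = 0]
    [set x | T (U x) = x] [set x | T (U x) = 0].
Proof.
move=> oT oU UTU; have oUT := modop_comp oU oT; have oTU := modop_comp oT oU.
have fix_closed W : modop W -> closed_submodule [set x | W x = x].
  move=> oW; rewrite (_ : [set _ | _] = [set x | x - W x = 0]).
    by apply: closed_submodule_ker; exact: modop_sub modop_id oW.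
  by apply/seteqP; split=> x /= h; [rewrite h subrr|apply/esym/subr0_eq].
have sum W : modop W -> (forall x, W (W x) = W x) ->
    direct_sum [set x | W x = x] [set x | W x = 0].
  move=> oW WW; split=> [x|x /= -> ->] //.
  exists (W x), (x - W x); split=> //=; first by rewrite modopB // WW subrr.
  by rewrite -hseqD addrC subrK.
split.
- by split; [exact: (fix_closed _ oUT)|exact: (closed_submodule_ker oUT)].
- by split; [exact: (fix_closed _ oTU)|exact: (closed_submodule_ker oTU)].
- split; [apply: (sum _ oUT)|apply: (sum _ oTU)] => x /=; first by rewrite UTU.
  by rewrite UTU.
- by split=> _ [x /= UTx <-] /=; rewrite UTx // modop0.
- split.
  + by move=> x y z a _ _ _ /hseq_comb ->; rewrite oT.1.
  + by have [_ [c cT]] := (modopP T).1 oT; exists c => x _; exact: cT.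
  + split=> [x /= UTx|x y /set_mem /= {2}<- /set_mem /= {2}<- -> //|y /= TUy].
      by rewrite UTx.
    by exists (U y) => //=; rewrite UTU.
  + have [_ [c cU]] := (modopP U).1 oU; exists c => x /= {1}<-.
    exact: cU.
Qed.

(** E x is the unique u in M1 such that x - T u is in N2.  Its graph is closed,
so the open mapping theorem bounds E. *)
Lemma quasi_inverse_of_decomposition T M1 N1 M2 N2 : modop T ->
  MPhi_decomposition T M1 N1 M2 N2 ->
  exists E, [/\ modop E, forall x, N1 (x - E (T x))
    & forall x, N2 (x - T (E x))].
Proof.
move=> oT [[cM1 cN1] [cM2 cN2] [[s1 _] [s2 i2]] [TM TN] [_ _ [_ inj surj] _]].
have subB M x y : closed_submodule M -> M x -> M y -> M (x - y).
  move=> [_ Mc _] Mx My; apply: (Mc y x _ (- 1)) => //.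
  apply/hseq_comb; rewrite addrC; congr (_ + _).
  by apply: HA_inj; apply/funext => i; rewrite /hact /hseq /= /ract mulrN1.
have subZ M x a : closed_submodule M -> M x -> M (hact x a).
  move=> [M0 Mc _] Mx; apply: (Mc x 0 _ a) => //; first exact: M0.
  by apply/hseq_comb; rewrite addr0.
have sub0 (M : set (HA A)) : closed_submodule M -> M 0.
  by move=> [M0 _ _]; exact: M0.
have subD M x y : closed_submodule M -> M x -> M y -> M (x + y).
  move=> cM Mx My; have M0 := sub0 M cM.
  have MNy : M (- y) by rewrite -sub0r; exact: subB.
  by rewrite -[y]opprK; exact: subB.
have subcl (M : set (HA A)) x : closed_submodule M ->
    (forall e, 0 < e -> exists2 y, M y & `|x - y| <= e) -> M x.
  move=> [_ _ Mc] xM; apply: Mc => z z0.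
  have zE : z = (complex.Re z)%:C by rewrite RRe_real // gtr0_real.
  move: z0; rewrite zE ltcR; set e := complex.Re z => e0.
  have [|y My xy] := xM (e / 2); first by rewrite divr_gt0.
  exists y => //; rewrite -hseqB hnorm_norm ltcR (le_lt_trans xy) //.
  by rewrite gtr_pMr // invf_lt1 // ltr1n.
pose Gr u x := M1 u /\ N2 (x - T u).
have GrD x y u v a : Gr u x -> Gr v y -> Gr (hact u a + v) (hact x a + y).
  move=> [Mu Nx] [Mv Ny]; split; first by apply: subD => //; exact: subZ.
  have -> : hact x a + y - T (hact u a + v) = hact (x - T u) a + (y - T v).
    by rewrite oT.1 hactDl hactNl opprD addrACA.
  by apply: subD => //; exact: subZ.
have Gr_uniq x u v : Gr u x -> Gr v x -> u = v.
  move=> [Mu Nu] [Mv Nv]; apply: inj; [exact/mem_set|exact/mem_set|].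
  apply/subr0_eq/HA_inj/i2.
    by apply: subB => //; apply: TM; [exists u|exists v].
  have -> : T u - T v = (x - T v) - (x - T u).
    by rewrite opprB [RHS](AC (2*2) ((1*4)*(3*2))) /= subrr add0r.
  exact: subB.
have Gr_ex x : exists u, Gr u x.
  have [m [n [Mm Nn /(HA_inj (y := m + n)) ->]]] := s2 x.
  have [u Mu um] := surj _ Mm; exists u; split=> //.
  by rewrite um addrC addKr.
have [E EP] := choice Gr_ex.
have EE x u : Gr u x -> E x = u by move=> ux; exact: Gr_uniq (EP x) ux.
exists E; split.
- split=> [x y a|]; first by apply: EE; exact: GrD.
  have [|||c c0 cE] := @open_mapping_relation R (HA A) (HA A) Gr _ _ _ Gr_ex.
  + move=> u v x y [Mu Nx] [Mv Ny]; split; first exact: subB.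
    have -> : x - y - T (u - v) = (x - T u) - (y - T v).
      by rewrite (modopB _ _ oT) !opprB [RHS](AC (2*2) ((1*4)*(3*2))) /=.
    exact: subB.
  + move=> t u x [Mu Nx]; rewrite -!hact_scale.
    split; first exact: subZ.
    set s := t%:C *: (1 : A).
    have -> : hact x s - T (hact u s) = hact (x - T u) s.
      by rewrite modop_hact // hactDl hactNl.
    exact: subZ.
  + move=> u x cl; have [_ [d d0 Td]] := oT; split; apply: subcl => // e e0.
      by have [v [y [[Mv _] uv _]]] := cl _ e0; exists v.
    have d10 : 0 < d + 1 by rewrite ltr_wpDl.
    have [v [y [[_ Ny] uv xy]]] := cl (e / (d + 1)) (divr_gt0 e0 d10).
    exists (y - T v) => //.
    have -> : x - T u - (y - T v) = (x - y) - T (u - v).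
      by rewrite (modopB _ _ oT) !opprB [RHS](AC (2*2) ((1*4)*(3*2))) /=.
    rewrite (le_trans (ler_normB _ _)) //; have := Td (u - v).
    move: uv xy; rewrite !ler_pdivlMr //; have := normr_ge0 (u - v); nra.
  + exists c => // x; have [u ux uc] := cE x.
    by rewrite (EE _ _ ux).
- move=> x; have [m [n [Mm Nn /(HA_inj (y := m + n)) ->]]] := s1 x.
  rewrite (EE _ m) ?[m + n - m]addrC ?addKr //; split=> //.
  by rewrite modopD // addrC addKr; apply: TN; exists n.
- by move=> x; have [] := EP x.
Qed.

End Operators.
Arguments modop_id {R A}.

(** * Atkinson theory of the standard module *)

Section Atkinson.
Context (R : realType) (A : cstarAlgType R).
Implicit Types (a b : A) (x y z : HA A) (e c t : R) (k m n : nat).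
Implicit Types (F G T U E P S : HA A -> HA A).

Definition tail_seq k (u : nat -> A) : nat -> A :=
  fun n => if (n < k)%N then 0 else u n.

Lemma segnorm_tail_seq m n k u : segnorm m n (tail_seq k u) <= segnorm m n u.
Proof.
rewrite ler_sqrt ?nrm_ge0 //; apply: pos_nrm_le; first exact: pos_sqsum.
rewrite /sqsum -sumrB; apply: pos_sum => i _; rewrite /tail_seq.
case: ifP => _; last by rewrite subrr; exact: pos0.
by rewrite mulr0 subr0; exact: pos_star_mul.
Qed.

Lemma l2_tail_seq k u : l2 A u -> l2 A (tail_seq k u).
Proof.
by apply: (l2_dominated (t := 1)) => m n; rewrite mul1r segnorm_tail_seq.
Qed.

Definition tail k x : HA A := HAof (l2_tail_seq (k := k) (HAP x)).

Lemma tailE k x n : hseq (tail k x) n = if (n < k)%N then 0 else hseq x n.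
Proof. by []. Qed.

Lemma tail_norm k x : `|tail k x| <= `|x|.
Proof.
apply: l2norm_le => [|n]; first exact: (HAP (tail k x)).
exact: le_trans (segnorm_tail_seq _ _ _ _) (segnorm_le_l2norm n (HAP x)).
Qed.

Lemma modop_tail k : modop (tail k).
Proof.
split; last by exists 1 => // x; rewrite mul1r tail_norm.
move=> x y a; apply: HA_inj; apply/funext => n.
rewrite tailE -[RHS]/(hseq (tail k x) n * a + hseq (tail k y) n) !tailE.
by case: ifP => // _; rewrite mul0r addr0.
Qed.

Lemma tail_tail k m x : (k <= m)%N -> tail m (tail k x) = tail m x.
Proof.
move=> km; apply: HA_inj; apply/funext => n; rewrite !tailE.
by case: ltnP => // mn; rewrite ltnNge (leq_trans km mn).
Qed.

Lemma tail_small x e : 0 < e -> exists k, `|tail k x| <= e.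
Proof.
move=> e0; have [k xk] := (l2P (hseq x)).1 (HAP x) _ e0; exists k.
apply: l2norm_le => [|n]; first exact: (HAP (tail k x)).
rewrite (le_trans _ (xk k n (leqnn k))) //.
rewrite (segnorm_le _ _ _ (segnorm_ge0 _ _ _)) segnorm_sqr.
have [kn|nk] := leqP k n.
  rewrite /sqsum (big_cat_nat (leq0n k) kn) /= big_nat big1 ?add0r.
    rewrite le_eqVlt; apply/orP; left; apply/eqP; congr nrm.
    rewrite !big_nat; apply: eq_bigr => i /andP[ki _].
    by rewrite tailE ltnNge ki.
  by move=> i /andP[_ ik]; rewrite tailE ik mulr0.
rewrite /sqsum big_nat big1 ?nrm0 ?nrm_ge0 // => i /andP[_ ii].
by rewrite tailE (ltn_trans ii nk) mulr0.
Qed.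

Definition delta_seq k : nat -> A := fun n => if n == k then 1 else 0.

Lemma l2_delta_seq k : l2 A (delta_seq k).
Proof.
apply/l2P => e e0; exists k.+1 => m n km.
rewrite /segnorm /sqsum big_nat big1 ?nrm0 ?sqrtr0 ?ltW // => i /andP[mi _].
by rewrite /delta_seq gtn_eqF ?mulr0 // (leq_trans km).
Qed.

Definition delta k : HA A := HAof (l2_delta_seq (k := k)).

Lemma hseq_sum (I : Type) (r : seq I) (f : I -> HA A) n :
  hseq (\sum_(i <- r) f i) n = \sum_(i <- r) hseq (f i) n.
Proof. by apply: (big_morph (fun x => hseq x n)). Qed.

Lemma delta_sumE k (a : 'I_k -> A) (n : 'I_k) :
  hseq (\sum_(i < k) hact (delta i) (a i)) n = a n.
Proof.
rewrite hseq_sum (bigD1 n) //= big1 => [|i ni].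
  by rewrite addr0 /hact /hseq /= /ract /delta_seq eqxx mul1r.
rewrite /hact /hseq /= /ract /delta_seq ifN ?mul0r //.
by apply: contra ni => /eqP/val_inj ->.
Qed.

Lemma tail_delta k (a : 'I_k -> A) :
  tail k (\sum_(i < k) hact (delta i) (a i)) = 0.
Proof.
rewrite modop_sum; last exact: modop_tail.
apply: big1 => i _; rewrite modop_hact; last exact: modop_tail.
rewrite (_ : tail k (delta i) = 0) ?hact0l //.
apply: HA_inj; apply/funext => n; rewrite tailE; case: ltnP => // kn.
by rewrite /delta /hseq /= /delta_seq gtn_eqF // (leq_trans (ltn_ord i)).
Qed.

Lemma head_tail k x : tail k x = x - \sum_(i < k) hact (delta i) (hseq x i).
Proof.
apply: HA_inj; apply/funext => n.
rewrite tailE -[RHS]/(hseq x n - hseq (\sum_(i < k) _) n).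
case: ltnP => nk.
  by rewrite (@delta_sumE k (fun i => hseq x i) (Ordinal nk)) subrr.
rewrite hseq_sum big1 ?subr0 // => i _.
rewrite /hact /hseq /= /ract /delta_seq gtn_eqF ?mul0r //.
exact: leq_trans (ltn_ord i) nk.
Qed.

(** When S is invertible with inverse B, this kernel is the image under B of
the span of the first k basis vectors. *)
Lemma finitely_generated_ker_tail S B k : modop S -> modop B ->
  (forall x, B (S x) = x) -> (forall x, S (B x) = x) ->
  finitely_generated [set x | tail k (S x) = 0].
Proof.
move=> oS oB BS SB; exists k, (fun i => B (delta i)) => x.
have sumE (a : 'I_k -> A) : \sum_(i < k) hact (B (delta i)) (a i) =
    B (\sum_(i < k) hact (delta i) (a i)).
  by rewrite modop_sum //; apply: eq_bigr => i _; rewrite modop_hact.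
have rsumE (a : 'I_k -> A) : \sum_(i < k) ract (hseq (B (delta i))) (a i) =
    hseq (\sum_(i < k) hact (B (delta i)) (a i)).
  by apply/esym/(big_morph (@hseq R A)).
split=> [/= Sx|[a]].
  exists (fun i => hseq (S x) i); rewrite rsumE sumE.
  have := head_tail k (S x); rewrite Sx => /esym/subr0_eq <-.
  by rewrite BS.
by rewrite rsumE => /HA_inj ->; rewrite /= sumE SB tail_delta.
Qed.

(** The coefficients are carried by an element z of H_A, of which only the first
k coordinates matter; this puts their size under control of one norm. *)
Definition finite_rank F := exists k (g : 'I_k -> HA A), exists2 c, 0 <= c &
  forall x, exists2 z, F x = \sum_(i < k) hact (g i) (hseq z i) &
    `|z| <= c * `|x|.

(** The norm limits of their truncations to the first k coordinates.  Among the
bounded module maps, adjointable or not, they play the role of the compact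
operators. *)
Definition tail_compact F :=
  forall e, 0 < e -> exists k, forall x, `|tail k (F x)| <= e * `|x|.

Lemma finite_rank_comp E F G : modop E -> modop G -> finite_rank F ->
  finite_rank (E \o F \o G).
Proof.
move=> oE [_ [d d0 Gd]] [k [g [c c0 Fg]]].
exists k, (E \o g), (c * d); first exact: mulr_ge0.
move=> x; have [z Fz zc] := Fg (G x); exists z.
  by rewrite /= Fz modop_sum //; apply: eq_bigr => i _; rewrite modop_hact.
by rewrite (le_trans zc) // -mulrA ler_wpM2l.
Qed.

Lemma finite_rank_tail_compact F : finite_rank F -> tail_compact F.
Proof.
move=> [k [g [c c0 Fg]]] e e0.
have d0 : 0 < e / (k%:R * c + 1).
  by rewrite divr_gt0 // ltr_wpDl // mulr_ge0.
set d := e / _ in d0.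
have [n_ gn] := choice (fun i => tail_small (g i) d0).
exists (\max_(i < k) n_ i)%N => x; have [z -> zc] := Fg x.
rewrite modop_sum; last exact: modop_tail.
apply: (@le_trans _ _ (\sum_(i < k) d * (c * `|x|))).
  apply: (le_trans (ler_norm_sum _ _ _)); apply: ler_sum => i _.
  rewrite modop_hact; last exact: modop_tail.
  apply: (le_trans (hact_norm _ _)); apply: ler_pM; rewrite ?nrm_ge0 //.
    rewrite -(tail_tail _ (leq_bigmax i)).
    exact: le_trans (tail_norm _ _) (gn i).
  exact: le_trans (nrm_coord_le _ _) zc.
have p0 : 0 < k%:R * c + 1 by rewrite ltr_wpDl // mulr_ge0.
have -> : \sum_(i < k) d * (c * `|x|) =
    e * ((k%:R * c) / (k%:R * c + 1)) * `|x|.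
  by rewrite sumr_const card_ord -mulr_natl /d; field; rewrite gt_eqF.
by rewrite ler_wpM2r // ger_pMr // ler_pdivrMr // mul1r lerDl.
Qed.

Lemma tail_compactD F G : tail_compact F -> tail_compact G ->
  tail_compact (fun x => F x + G x).
Proof.
move=> cF cG e e0; have e2 : 0 < e / 2 by rewrite divr_gt0.
have [k Fk] := cF _ e2; have [m Gm] := cG _ e2; exists (maxn k m) => x.
rewrite modopD; last exact: modop_tail.
rewrite (le_trans (ler_normD _ _)) // [e]splitr mulrDl lerD //.
  rewrite -(tail_tail _ (leq_maxl k m)); exact: le_trans (tail_norm _ _) (Fk x).
rewrite -(tail_tail _ (leq_maxr k m)); exact: le_trans (tail_norm _ _) (Gm x).
Qed.

(** The relation P x = L z, with L z the combination of the generators with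
coefficients z, is closed and onto; the open mapping theorem selects
coefficients of size at most c |x|. *)
Lemma finite_rank_of_range P N : modop P -> finitely_generated N ->
  (forall x, N (P x)) -> finite_rank P.
Proof.
move=> oP [k [g gN]] PN; exists k, g.
pose L z := \sum_(i < k) hact (g i) (hseq z i).
have oL : modop L.
  split=> [x y a|].
    rewrite /L -[in LHS]/(hact x a + y).
    have hsum : hact (\sum_(i < k) hact (g i) (hseq x i)) a =
        \sum_(i < k) hact (hact (g i) (hseq x i)) a.
      apply: (big_morph (fun z => hact z a)) => [u v|]; first exact: hactDl.
      exact: hact0l.
    rewrite hsum -big_split /=; apply: eq_bigr => i _.
    by rewrite -[hseq (hact x a + y) i]/(hseq x i * a + hseq y i) hactDr hactA.
  exists (\sum_(i < k) `|g i|); first exact: sumr_ge0.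
  move=> x; rewrite mulr_suml (le_trans (ler_norm_sum _ _ _)) //.
  apply: ler_sum => i _; rewrite (le_trans (hact_norm _ _)) //.
  by rewrite ler_wpM2l // nrm_coord_le.
have LN x : exists z, P x = L z.
  have [a Pa] := (gN (P x)).1 (PN x).
  exists (\sum_(i < k) hact (delta i) (a i)); apply: HA_inj.
  rewrite Pa (_ : L _ = \sum_(i < k) hact (g i) (a i)).
    by apply/esym/(big_morph (@hseq R A)).
  by apply: eq_bigr => i _; rewrite delta_sumE.
have [|||c c0 cP] :=
  @open_mapping_relation R (HA A) (HA A) (fun z x => P x = L z) _ _ _ LN.
- by move=> z z' x x' Px Px'; rewrite (modopB _ _ oP) (modopB _ _ oL) Px Px'.
- by move=> t z x Px; rewrite -!hact_scale !modop_hact // Px.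
- move=> z x cl; have [_ [d d0 Pd]] := oP; have [_ [f f0 Lf]] := oL.
  apply/subr0_eq/normr0_eq0/eqP; rewrite eq_le normr_ge0 andbT.
  apply/ler_addgt0Pr => e e0; rewrite add0r.
  have df0 : 0 < d + f + 1 by lra.
  have [z' [x' [Px' zz xx]]] := cl (e / (d + f + 1)) (divr_gt0 e0 df0).
  have -> : P x - L z = P (x - x') - L (z - z').
    by rewrite (modopB _ _ oP) (modopB _ _ oL) Px' opprB addrA subrK.
  rewrite (le_trans (ler_normB _ _)) //.
  have := Pd (x - x'); have := Lf (z - z').
  move: zz xx; rewrite !ler_pdivlMr //.
  by have := normr_ge0 (z - z'); have := normr_ge0 (x - x'); nra.
- by exists c => // x; have [z Pz zc] := cP x; exists z.
Qed.

Lemma neumann_modop S : modop S -> (forall x, `|S x| <= `|x| / 2) ->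
  exists B, [/\ modop B, forall x, B (x - S x) = x
    & forall y, B y - S (B y) = y].
Proof.
move=> oS S2.
have [|B [BS SB B2]] := neumann _ S2; first by move=> x y; exact: modopB.
exists B; split=> //; split; last by exists 2.
move=> x y a; rewrite -[RHS]BS; congr B.
by rewrite oS.1 -{1}[x]SB -{1}[y]SB hactDl hactNl opprD addrACA.
Qed.

(** With t = tail k, S = t F of norm at most 1/2, V = 1 - S and B = V^-1, the
relation U T = 1 - F gives t U T = t V.  So W = B t U has W T = B t V and
W T W = B t (V B) t U = W, and W T vanishes exactly where t V does. *)
Lemma left_Atkinson T U F : modop T -> modop U -> tail_compact F ->
  (forall x, U (T x) = x - F x) ->
  exists M1 N1 M2 N2,
    MPhi_decomposition T M1 N1 M2 N2 /\ finitely_generated N1.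
Proof.
move=> oT oU cF UT; have oUT := modop_comp oU oT.
have oF : modop F.
  have -> : F = fun x => x - (U \o T) x.
    by apply/funext => x /=; rewrite UT opprB addrC subrK.
  exact: modop_sub modop_id oUT.
have [|k Fk] := cF 2^-1; first by rewrite invr_gt0.
have ot := modop_tail k.
have tt x : tail k (tail k x) = tail k x by exact: tail_tail.
pose S := tail k \o F; have oS : modop S by exact: modop_comp.
have [|B [oB BS SB]] := neumann_modop oS; first by move=> x; rewrite mulrC Fk.
pose V x := x - S x; have oV : modop V := modop_sub modop_id oS.
have tUT x : tail k (U (T x)) = tail k (V x).
  by rewrite UT /V !(modopB _ _ ot) tt.
pose W := B \o (tail k \o U).
have oW : modop W by apply: modop_comp => //; exact: modop_comp.
exists [set x | W (T x) = x], [set x | W (T x) = 0].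
exists [set x | T (W x) = x], [set x | T (W x) = 0]; split.
  apply: decomposition_of_quasi_inverse => // x.
  by rewrite /W /= tUT /V SB tt.
rewrite (_ : [set x | W (T x) = 0] = [set x | tail k (V x) = 0]).
  exact: finitely_generated_ker_tail oB BS SB.
apply/seteqP; split=> x; rewrite /W /= tUT; last by move=> ->; exact: modop0.
by move=> Bt; rewrite -[LHS]SB Bt (modop0 oS) subr0.
Qed.

(** With t = tail k, S = t F of norm at most 1/2 and B the inverse of 1 - S, the
map W = U B t satisfies t T W = t (1 - S) B t = t.  Hence W T W = W, and T W
vanishes exactly where t does. *)
Lemma right_Atkinson T U F : modop T -> modop U -> tail_compact F ->
  (forall x, T (U x) = x - F x) ->
  exists M1 N1 M2 N2,
    MPhi_decomposition T M1 N1 M2 N2 /\ finitely_generated N2.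
Proof.
move=> oT oU cF TU; have oTU := modop_comp oT oU.
have oF : modop F.
  have -> : F = fun x => x - (T \o U) x.
    by apply/funext => x /=; rewrite TU opprB addrC subrK.
  exact: modop_sub modop_id oTU.
have [|k Fk] := cF 2^-1; first by rewrite invr_gt0.
have ot := modop_tail k.
have tt x : tail k (tail k x) = tail k x by exact: tail_tail.
pose S := tail k \o F; have oS : modop S by exact: modop_comp.
have [|B [oB BS SB]] := neumann_modop oS; first by move=> x; rewrite mulrC Fk.
pose W := U \o (B \o tail k).
have oW : modop W by apply: modop_comp => //; exact: modop_comp.
have tTW x : tail k (T (W x)) = tail k x.
  rewrite /W /= TU (modopB _ _ ot); set y := B _.
  rewrite -[tail k (F y)]tt -(modopB _ _ ot) -[tail k (F y)]/(S y).
  by rewrite SB tt.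
exists [set x | W (T x) = x], [set x | W (T x) = 0].
exists [set x | T (W x) = x], [set x | T (W x) = 0]; split.
  apply: decomposition_of_quasi_inverse => // x.
  by rewrite {1}/W /= tTW.
rewrite (_ : [set x | T (W x) = 0] = [set x | tail k x = 0]).
  exact: (finitely_generated_ker_tail k modop_id modop_id).
apply/seteqP; split=> x /= h; first by rewrite -tTW h modop0.
by rewrite /W /= h (modop0 oB) (modop0 oU) (modop0 oT).
Qed.

Lemma Ba_modop F : Ba A F -> modop F.
Proof. by move=> [Fl Fb _]; apply/modopP. Qed.

Lemma Ba_comp F G : Ba A F -> Ba A G -> Ba A (F \o G).
Proof.
move=> BF BG.
have [Fl Fb] := (modopP _).1 (modop_comp (Ba_modop BF) (Ba_modop BG)).
split=> //; have [_ _ [F' FF']] := BF; have [_ _ [G' GG']] := BG.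
by exists (G' \o F') => x y /=; rewrite FF' GG'.
Qed.

(** If E F = 1 - P and D G = 1 - Q, then D E F G = 1 - (Q + D P G). *)
Lemma MPhi_plus_comp F G :
  MPhi_plus A F -> MPhi_plus A G -> MPhi_plus A (F \o G).
Proof.
move=> [BF [? [N [? [? [dF fgN]]]]]] [BG [? [N' [? [? [dG fgN']]]]]].
split; first exact: Ba_comp.
have oF := Ba_modop BF; have oG := Ba_modop BG.
have [E [oE EN _]] := quasi_inverse_of_decomposition oF dF.
have [D [oD DN _]] := quasi_inverse_of_decomposition oG dG.
pose P x := x - E (F x); pose Q x := x - D (G x).
have fP : finite_rank P.
  apply: finite_rank_of_range fgN EN.
  exact: modop_sub modop_id (modop_comp oE oF).
have fQ : finite_rank Q.
  apply: finite_rank_of_range fgN' DN.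
  exact: modop_sub modop_id (modop_comp oD oG).
have oFG := modop_comp oF oG; have oDE := modop_comp oD oE.
apply: (left_Atkinson (F := fun x => Q x + (D \o P \o G) x) oFG oDE).
  apply: tail_compactD; apply: finite_rank_tail_compact => //.
  exact: finite_rank_comp.
move=> x; rewrite /Q /P /= (modopB _ _ oD).
by rewrite [in RHS]addrA subrK opprB addrC subrK.
Qed.

(** If F E = 1 - P and G D = 1 - Q, then F G D E = 1 - (P + F Q E). *)
Lemma MPhi_minus_comp F G :
  MPhi_minus A F -> MPhi_minus A G -> MPhi_minus A (F \o G).
Proof.
move=> [BF [? [? [? [N [dF fgN]]]]]] [BG [? [? [? [N' [dG fgN']]]]]].
split; first exact: Ba_comp.
have oF := Ba_modop BF; have oG := Ba_modop BG.
have [E [oE _ EN]] := quasi_inverse_of_decomposition oF dF.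
have [D [oD _ DN]] := quasi_inverse_of_decomposition oG dG.
pose P x := x - F (E x); pose Q x := x - G (D x).
have fP : finite_rank P.
  apply: finite_rank_of_range fgN EN.
  exact: modop_sub modop_id (modop_comp oF oE).
have fQ : finite_rank Q.
  apply: finite_rank_of_range fgN' DN.
  exact: modop_sub modop_id (modop_comp oG oD).
have oFG := modop_comp oF oG; have oDE := modop_comp oD oE.
apply: (right_Atkinson (F := fun x => P x + (F \o Q \o E) x) oFG oDE).
  apply: tail_compactD; apply: finite_rank_tail_compact => //.
  exact: finite_rank_comp.
move=> x; rewrite /Q /P /= (modopB _ _ oF).
by rewrite [in RHS]addrA subrK opprB addrC subrK.
Qed.

End Atkinson.

Theorem corollary2p5 (R : realType) (A : cstarAlgType R) :
  is_semigroup (fun G F : HA A -> HA A => G \o F) (MPhi_plus A) /\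
  is_semigroup (fun G F : HA A -> HA A => G \o F) (MPhi_minus A).
Proof.
split; split=> // F G; [exact: MPhi_plus_comp|exact: MPhi_minus_comp].
Qed.
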